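(* For each integer $n \le 32$, let $N(n)$ denote the number of isomorphism classes of semi-equivelar maps of type $\{3^{2},4,3,4\}$ on the torus with exactly $n$ vertices. Then $N(16)=2$, $N(20)=1$, $N(24)=3$, $N(28)=1$, $N(32)=5$, and $N(n)=0$ for every other $n\le 32$.
   Context: A map on the torus is an embedding of a finite simple graph on the torus such that the closure of each connected component of the complement of the graph (a face) is a closed 2-cell; a face with $p$ vertices is a $p$-gon. A map is semi-equivelar of type $\{3^{2},4,3,4\}$ if at every vertex $v$ the faces incident with $v$, read in cyclic order around $v$, have sizes $(3,3,4,3,4)$ (up to rotation and reversal). Two maps are isomorphic if there is a bijection between their vertex sets that maps the vertex sets of faces of one map exactly onto the vertex sets of faces of the other.
   Formalization: Maps are additionally required to be polyhedral: two distinct faces are disjoint or meet in one vertex or one edge. Without this the claim fails: there is a map of this type on 8 vertices whose faces are closed 2-cells, so N(8) would not be 0. *)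

(* Defs.v *)
From mathcomp Require Import all_boot fingroup perm.

Set Implicit Arguments.
Unset Strict Implicit.
Unset Printing Implicit Defensive.

(* A cellular embedding of a finite simple graph in an oriented closed surface
   is encoded, as usual (Heffter-Edmonds), by its rotation system: the set of
   darts (both orientations of every edge) and, for each vertex v, the
   permutation taking a neighbour of v to the next neighbour in the positive
   cyclic order around v.  The values of [turn M v] outside the neighbourhood
   of v carry no meaning. *)
Definition rotation_system (V : finType) : finType :=
  ({set V * V} * {ffun V -> {perm V}})%type.

Section Maps.

Variable V : finType.
Implicit Types (M : rotation_system V) (u v w : V) (d : V * V).

Definition darts M : {set V * V} := M.1.
Definition turn M v : {perm V} := M.2 v.
Definition adj M : rel V := fun u v => (u, v) \in darts M.
Definition nbhd M v : {set V} := [set u | adj M v u].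

Definition simple_graph M : bool :=
  [forall u, ~~ adj M u u] && [forall u, forall v, adj M u v ==> adj M v u].

Definition connected_graph M : bool :=
  (0 < #|V|) && [forall u, forall v, connect (adj M) u v].

Definition cyclic_rotations M : bool :=
  [forall v, forall u in nbhd M v, porbit (turn M v) u == nbhd M v].

(* Face tracing: after traversing u -> v, leave v along the edge following
   vu in the rotation at v.  The faces are the orbits on the darts. *)
Definition face_step M d : V * V := (d.2, turn M d.2 d.1).

Lemma face_step_inj M : injective (face_step M).
Proof. by case=> u v [u' v'] [<-] /perm_inj ->. Qed.

Definition face_perm M : {perm V * V} := perm (@face_step_inj M).
Definition face_at M d : {set V * V} := porbit (face_perm M) d.
Definition faces M : {set {set V * V}} := [set face_at M d | d in darts M].
Definition face_vertices (f : {set V * V}) : {set V} := [set d.1 | d in f].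

(* The boundary walk of every face is a simple cycle: it has as many vertices
   as darts. *)
Definition closed_cell_faces M : bool :=
  [forall f in faces M, (2 < #|f|) && (#|face_vertices f| == #|f|)].

(* #|V| - #|E| + #|F| = 0, where #|darts M| = 2 #|E|.  Among the connected
   closed orientable surfaces this singles out the torus. *)
Definition euler_char_zero M : bool := #|darts M| == (#|V| + #|faces M|).*2.

Definition torus_map M : bool :=
  [&& simple_graph M, connected_graph M, cyclic_rotations M,
      closed_cell_faces M & euler_char_zero M].

(* Two distinct faces are disjoint, or meet in a single vertex, or meet in a
   single common edge.  A common edge is traversed by the two faces in
   opposite directions. *)
Definition polyhedral M : bool :=
  [forall f in faces M, forall g in faces M, (f != g) ==>
     let I := face_vertices f :&: face_vertices g in
     (#|I| <= 1) ||
     [exists u, exists v,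
        [&& I == [set u; v], (u, v) \in f & (v, u) \in g]]].

(* The face between the edges vu and v(turn M v u) is the one containing the
   dart (u, v), so this lists the face sizes in cyclic order around v. *)
Definition face_sizes_around M v u : seq nat :=
  [seq #|face_vertices (face_at M (w, v))|
     | w <- traject (turn M v) u #|nbhd M v|].

Definition semi_equivelar (t : seq nat) M : bool :=
  [forall v, exists u in nbhd M v,
     (face_sizes_around M v u == t) || (face_sizes_around M v u == rev t)].

Definition face_vertex_sets M : {set {set V}} :=
  [set face_vertices f | f in faces M].

Definition map_iso : rel (rotation_system V) := fun M1 M2 =>
  [exists s : {perm V},
     [set s @: A | A : {set V} in face_vertex_sets M1]
       == face_vertex_sets M2].

Lemma map_iso_equiv : equivalence_rel map_iso.
Proof.
have iE (s t : {perm V}) (S : {set {set V}}) :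
    [set (s * t)%g @: A | A : {set V} in S]
      = [set t @: A | A : {set V} in [set s @: B | B : {set V} in S]].
  rewrite -imset_comp; apply: eq_imset => A /=; rewrite -imset_comp.
  by apply: eq_imset => x; rewrite permM.
have i1 (S : {set {set V}}) : [set (1%g : {perm V}) @: A | A : {set V} in S] = S.
  rewrite -[RHS]imset_id; apply: eq_imset => A /=.
  by rewrite -[RHS]imset_id; apply: eq_imset => x; rewrite perm1.
have iso_sym M1 M2 : map_iso M1 M2 -> map_iso M2 M1.
  case/existsP=> s /eqP e; apply/existsP; exists s^-1%g.
  by rewrite -e -iE mulgV i1.
have iso_trans M1 M2 M3 : map_iso M1 M2 -> map_iso M2 M3 -> map_iso M1 M3.
  case/existsP=> s /eqP es /existsP[t /eqP et]; apply/existsP.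
  by exists (s * t)%g; rewrite iE es et.
move=> M1 M2 M3; split; first by apply/existsP; exists 1%g; rewrite i1.
by move=> e; apply/idP/idP; [apply: iso_trans (iso_sym _ _ e) | apply: iso_trans e].
Qed.

End Maps.

(* "Map" is taken to mean polyhedral map, the usual convention in the
   literature on semi-equivelar maps.  Without polyhedrality there is, e.g.,
   a map of type {3^2,4,3,4} on 8 vertices, with faces
     025 036 057 134 127 146 247 356 0642 0743 1753 1652
   (the 4-gons 0642 and 0743 share the non-adjacent vertices 0 and 4). *)
Definition snub_square_torus_maps (n : nat) : {set rotation_system 'I_n} :=
  [set M | [&& torus_map M, polyhedral M
             & semi_equivelar [:: 3; 3; 4; 3; 4] M]].

Definition num_iso_classes (n : nat) : nat :=
  #|equivalence_partition (@map_iso 'I_n) (snub_square_torus_maps n)|.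

(* Main.v *)
Require Import Defs.
From mathcomp Require Import all_boot fingroup perm zmodp zify.

(* Around every vertex of a snub square map there is exactly one edge lying
   between two triangles.  Sending v to the other end of this edge is an
   involution a; sending v to the end of the next edge in the rotation at v is
   a permutation b with b^4 = (b a)^4 = 1.  So the group p4 = <a, b> acts
   transitively on the vertices, and simplicity of the faces makes all its
   rotations act freely.  The vertex set is therefore Z^2/H x Z/4, where
   X = b b a and Y = b a b are the unit translations and the lattice H of index
   n/4 has a Hermite normal form (p, q, r): r is the order of Y, and p is least
   such that X^p = Y^q on the base vertex.  Polyhedrality says that H contains
   none of (1, 0), (0, 1), (1, 1), (1, -1).  For n <= 32 there are finitely many
   such lattices; up to the symmetries of the square tiling they reduce to
   twelve, all of which give polyhedral maps.  These are told apart by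
   the number of vertex pairs (u, v) such that v is reached from a vertex
   sharing a triangle with u by three steps along diagonals of 4-gons. *)

Set Implicit Arguments.
Unset Strict Implicit.
Unset Printing Implicit Defensive.

(** * Labelled rotation systems and their faces *)

Local Arguments face_step : simpl never.

Section Labels.

Variables (T : eqType) (a b : T -> T).
Implicit Type v : T.

(* a v is the neighbour of v across the edge lying between two triangles, and
   [:: a v; b v; bi v; a (bi v); ci v] are the neighbours of v in positive cyclic
   order, separated by a triangle, a 4-gon, a triangle, a 4-gon, a triangle.
   When b^4 = (b a)^4 = 1, bi = b^-1 and ci is inverse to v |-> a (bi v). *)
Definition bi v := b (b (b v)).
Definition ci v := b (a v).
Definition spokes v := [:: a v; b v; bi v; a (bi v); ci v].
Definition tri v := [:: v; a v; ci v].
Definition bsq v := traject bi v 4.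
Definition csq v := traject ci v 4.
Definition tri_darts v := [:: (v, a v); (a v, ci v); (ci v, v)].
Definition bsq_darts v := [seq (x, bi x) | x <- bsq v].
Definition csq_darts v := [seq (x, ci x) | x <- csq v].

Definition snub_action :=
  [/\ forall v, a (a v) = v, forall v, iter 4 b v = v & forall v, iter 4 ci v = v].

Definition simple_action :=
  forall v, [&& uniq (v :: spokes v), uniq (bsq v) & uniq (csq v)].

End Labels.

(** Any period [k] will do, not only the least one, so faces can be listed before their darts are
    known to be distinct. *)
Lemma porbit_traject_period (T : finType) (s : {perm T}) x k :
  0 < k -> iter k s x = x -> porbit s x = [set:: traject s x k].
Proof.
move=> k_gt0 kx; apply/setP=> y; rewrite inE; apply/porbitP/trajectP.
  case=> i ->; exists (i %% k); first by rewrite ltn_mod.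
  rewrite permX {1}(divn_eq i k) addnC iterD; congr (iter _ _ _).
  by elim: (i %/ k) => //= j IHj; rewrite mulSn iterD IHj.
by case=> i _ ->; exists i; rewrite permX.
Qed.

Section Labelling.

Variables (V : finType) (M : rotation_system V).

Definition labelled (a b : V -> V) :=
  [/\ snub_action a b, forall v, uniq (spokes a b v),
      forall v, adj M v =i spokes a b v
    & forall v, [/\ turn M v (a v) = b v, turn M v (b v) = bi b v,
                    turn M v (bi b v) = a (bi b v),
                    turn M v (a (bi b v)) = ci a b v
                  & turn M v (ci a b v) = a v]].

Lemma face_at_step d : face_at M (face_step M d) = face_at M d.
Proof.
apply/eqP; rewrite eq_porbit_mem -[face_step M d](permE (@face_step_inj _ M)).
exact: (mem_porbit _ 1).
Qed.

Lemma face_at_traject d k :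
  0 < k -> iter k (face_step M) d = d ->
  face_at M d = [set:: traject (face_step M) d k].
Proof.
have E : face_perm M =1 face_step M by move=> x; rewrite permE.
have Ei j x : iter j (face_perm M) x = iter j (face_step M) x by apply: eq_iter.
move=> k_gt0 kd; rewrite /face_at (porbit_traject_period k_gt0) ?Ei //.
apply/setP=> y; rewrite !inE; apply/trajectP/trajectP=> -[i lik ->];
  by exists i; rewrite ?Ei.
Qed.

(** * Tracing the faces of a labelled map *)

Section Faces.

Variables a b : V -> V.
Hypothesis lab : labelled a b.
Let aK : forall v, a (a v) = v. Proof. by case: lab => -[]. Qed.
Let bK : forall v, bi b (b v) = v.
Proof. by case: lab => -[_ h _] _ _ _ v; exact: (h v). Qed.
Let biK : forall v, b (bi b v) = v. Proof. exact: bK. Qed.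
Let ciK : forall v, a (bi b (ci a b v)) = v.
Proof. by move=> v; rewrite /ci bK aK. Qed.
Let turns := let: And4 _ _ _ h := lab in h.
Let b4 : forall v, iter 4 (bi b) v = v.
Proof. by move=> v; rewrite /= /bi !(bK : forall v, b (b (b (b v))) = v). Qed.
Let c4 : forall v, iter 4 (ci a b) v = v. Proof. by case: lab => -[]. Qed.

(** Tracing needs the tail [v] as a spoke of the head: reversing an edge keeps the label [a] and
    exchanges [b] with [bi], and [ci] with [a (bi _)]. Each of the five steps is then read off the
    rotation at the head. *)
Lemma face_step_a v : face_step M (v, a v) = (a v, b (a v)).
Proof. by rewrite /face_step /=; case: (turns (a v)); rewrite aK => ->. Qed.

Lemma face_step_b v : face_step M (v, b v) = (b v, a (bi b (b v))).
Proof. by rewrite /face_step /=; case: (turns (b v)); rewrite bK => _ _ ->. Qed.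

Lemma face_step_bi v : face_step M (v, bi b v) = (bi b v, bi b (bi b v)).
Proof. by rewrite /face_step /=; case: (turns (bi b v)); rewrite biK => _ ->. Qed.

Lemma face_step_c v :
  face_step M (v, a (bi b v)) = (a (bi b v), a (a (bi b v))).
Proof.
rewrite /face_step /=; case: (turns (a (bi b v))) => _ _ _ _.
by rewrite {1}/ci aK biK => ->.
Qed.

Lemma face_step_ci v : face_step M (v, ci a b v) = (ci a b v, ci a b (ci a b v)).
Proof.
by rewrite /face_step /=; case: (turns (ci a b v)) => _ _ _; rewrite ciK => ->.
Qed.

Lemma labelled_bi4 v : iter 4 (bi b) v = v. Proof. exact: b4. Qed.

Lemma face_at_a v : face_at M (v, a v) = [set:: tri_darts a b v].
Proof. by rewrite (@face_at_traject _ 3) //= ?face_step_a ?face_step_b ?face_step_c ?bK ?aK. Qed.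

Lemma face_at_bi v : face_at M (v, bi b v) = [set:: bsq_darts b v].
Proof. by rewrite (@face_at_traject _ 4) //= !face_step_bi //; have /= -> := b4 v. Qed.

Lemma face_at_ci v : face_at M (v, ci a b v) = [set:: csq_darts a b v].
Proof. by rewrite (@face_at_traject _ 4) //= !face_step_ci //; have /= -> := c4 v. Qed.

Lemma face_at_b v : face_at M (v, b v) = [set:: tri_darts a b (a v)].
Proof. by rewrite -face_at_a -[RHS]face_at_step face_step_a !aK. Qed.

Lemma face_at_c v : face_at M (v, a (bi b v)) = [set:: tri_darts a b (a (bi b v))].
Proof. by rewrite -face_at_a -face_at_step face_step_c. Qed.

Lemma dartsE : darts M = [set d | d.2 \in spokes a b d.1].
Proof. by have [_ _ h _] := lab; apply/setP=> -[u v]; rewrite inE -h. Qed.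

Lemma faces_labelled f : reflect
  (exists v, [\/ f = [set:: tri_darts a b v], f = [set:: bsq_darts b v]
               | f = [set:: csq_darts a b v]])
  (f \in faces M).
Proof.
apply: (iffP imsetP) => [[[u v]]|[v]].
  rewrite dartsE inE /= !inE => /or4P[/eqP->|/eqP->|/eqP->|/orP[]/eqP->] ->.
  - by exists u; constructor 1; exact: face_at_a.
  - by exists (a u); constructor 1; exact: face_at_b.
  - by exists u; constructor 2; exact: face_at_bi.
  - by exists (a (bi b u)); constructor 1; exact: face_at_c.
  - by exists u; constructor 3; exact: face_at_ci.
by case=> ->; [rewrite -face_at_a; exists (v, a v)
  | rewrite -face_at_bi; exists (v, bi b v)
  | rewrite -face_at_ci; exists (v, ci a b v)] => //; rewrite dartsE !inE eqxx ?orbT.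
Qed.

Lemma face_vertices_seq (s : seq (V * V)) : face_vertices [set:: s] = [set:: map fst s].
Proof.
apply/setP=> x; rewrite inE; apply/imsetP/mapP.
  by case=> d; rewrite inE; exists d.
by case=> d ds ->; exists d; rewrite ?inE.
Qed.

Lemma face_vertex_sets_labelled A : reflect
  (exists v, [\/ A = [set:: tri a b v], A = [set:: bsq b v] | A = [set:: csq a b v]])
  (A \in face_vertex_sets M).
Proof.
apply: (iffP imsetP) => [[f /faces_labelled[v fv] ->]|[v]].
  by exists v; case: fv => ->; rewrite face_vertices_seq; constructor.
case=> ->; [exists [set:: tri_darts a b v]|exists [set:: bsq_darts b v]
  |exists [set:: csq_darts a b v]];
  rewrite ?face_vertices_seq //; apply/faces_labelled; exists v; by constructor.
Qed.

End Faces.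
End Labelling.

(** * From semi-equivelar maps to actions of p4 *)

(** The neighbour lying between two triangles starts a numbering of the five neighbours. The sizes
    on both sides of an edge restrict its labels at the two ends, closing up the triangles removes
    the remaining ambiguity, and the 4-gons give the relations of order four. *)
Lemma labelled_of_sizes (V : finType) (M : rotation_system V) :
  torus_map M -> semi_equivelar [:: 3; 3; 4; 3; 4] M ->
  exists a b : V -> V, labelled M a b.
Proof.
case/and5P=> /andP[irr symm] _ rot cells _ semi.
pose sz d := #|face_at M d|.
have szP d : d \in darts M -> #|face_vertices (face_at M d)| = sz d.
  move=> dM; have /implyP := forallP cells (face_at M d).
  by case/(_ (imset_f _ dM))/andP=> _ /eqP.
have sz_step d : sz (face_step M d) = sz d by rewrite /sz face_at_step.
have iter_sz d : iter (sz d) (face_step M) d = d.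
  rewrite -[RHS](iter_porbit (face_perm M)); apply: eq_iter => x.
  by rewrite permE.
have adjC u v : adj M u v -> adj M v u.
  by move=> uv; have /implyP := forallP (forallP symm u) v; exact.
(* [e] is the neighbour between the two triangles: the dart [(w, v)] lies on the face between [w]
   and its successor around [v]. *)
have /fin_all_exists[e eP] v : exists e, let t := turn M v in
    [/\ #|nbhd M v| = 5, nbhd M v =i traject t e 5, uniq (traject t e 5),
        iter 5 t e = e
      & [seq sz (w, v) | w <- traject t e 5] = [:: 3; 4; 3; 4; 3]].
  have /existsP[u /andP[uv sizes]] := forallP semi v.
  have porb w : w \in nbhd M v -> porbit (turn M v) w = nbhd M v.
    by move=> wv; have /implyP/(_ wv)/eqP := forallP (forallP rot v) w.
  have card5 : #|nbhd M v| = 5.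
    by case/orP: sizes => /eqP/(congr1 size); rewrite size_map size_traject.
  have nb w : w \in nbhd M v -> let t := turn M v in
     [/\ nbhd M v =i traject t w 5, uniq (traject t w 5) & iter 5 t w = w].
    move=> wv t; rewrite -card5 -(porb w wv); split.
    - exact: porbit_traject.
    - exact: uniq_traject_porbit.
    - exact: iter_porbit.
  have szs w : w \in nbhd M v ->
      face_sizes_around M v w = [seq sz (x, v) | x <- traject (turn M v) w 5].
    move=> wv; rewrite /face_sizes_around card5; apply/eq_in_map => x.
    have [<- _ _] := nb w wv; rewrite inE => vx; apply: szP; exact: adjC.
  have [nbu _ u5] := nb u uv.
  have itn k : k < 5 -> iter k (turn M v) u \in nbhd M v.
    by move=> lk; rewrite nbu; apply/trajectP; exists k.
  (* For the type itself [u] is one step before the wanted neighbour; for the reversed type it is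
     one step after it, hence four steps before. *)
  move: sizes; rewrite (szs u uv) => /orP[]/eqP sizes.
    have w1 := itn 1 isT; have [nbw Uw w5] := nb _ w1.
    exists (turn M v u); split=> //; move: sizes u5 => /= [s0 s1 s2 s3 s4] u5.
    by rewrite u5 s0 s1 s2 s3 s4.
  have w4 := itn 4 isT; have [nbw Uw w5] := nb _ w4.
  exists (iter 4 (turn M v) u); split=> //; move: sizes u5 => /= [s0 s1 s2 s3 s4] u5.
  by rewrite u5 s0 s1 s2 s3 s4.
pose E v i := iter i (turn M v) (e v).
(* Sizes of the faces of the darts entering and leaving [v] along its neighbour number [i]; the
   second list is the first, shifted by one. *)
pose inn i := nth 0 [:: 3; 4; 3; 4; 3] i.
pose out i := nth 0 [:: 3; 3; 4; 3; 4] i.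
have E5 v : E v 5 = E v 0 by have [_ _ _ h _] := eP v.
have EP v u : adj M v u -> exists2 i, i < 5 & u = E v i.
  by move=> vu; apply/trajectP; have [_ <- _ _ _] := eP v; rewrite inE.
have adjE v i : i < 5 -> adj M v (E v i).
  move=> i5; have [_ h _ _ _] := eP v.
  suff: E v i \in nbhd M v by rewrite inE.
  by rewrite h; apply/trajectP; exists i.
have E_inj v i j : i < 5 -> j < 5 -> E v i = E v j -> i = j.
  move=> i5 j5 eij; have [_ _ U _ _] := eP v; apply/eqP.
  by rewrite -(nth_uniq (e v) _ _ U) ?size_traject // !nth_traject //; apply/eqP.
have szE v i : i < 5 -> sz (E v i, v) = inn i.
  move=> i5; have [_ _ _ _ h] := eP v; rewrite /inn -h.
  by rewrite (nth_map (e v)) ?size_traject // nth_traject.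
have stepE v i : face_step M (E v i, v) = (v, E v i.+1) by [].
have szoutE v i : i < 5 -> sz (v, E v i) = out i.
  case: i => [|i] i5; last by rewrite -stepE sz_step szE 1?ltnW //; case: i i5 => [|[|[|[]]]].
  by rewrite -[E v 0](E5 v) -stepE sz_step szE.
have turnE v i : turn M v (E v i) = E v i.+1 by [].
clearbody E.
(* Reversing an edge swaps its two sides, which restricts its label [j] at the other end. *)
have back v i : i < 5 -> exists j, [/\ j < 5, v = E (E v i) j, inn j = out i & out j = inn i].
  move=> i5; have [j j5 vE] := EP _ _ (adjC _ _ (adjE v i i5)).
  exists j; split=> //; first by rewrite -(szE (E v i)) // -vE szoutE.
  by rewrite -(szoutE (E v i)) // -vE szE.
have E00 v : E (E v 0) 0 = v.
  by have [[|[|[|[|[|j]]]]] [//= _ {2}-> _ _]] := back v 0 isT.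
have stepE' v w i : v = E w i -> face_step M (v, w) = (w, E w i.+1) by move->.
(* The triangle v, a v, b (a v): its third corner lies between the neighbours
   2 and 3 of b (a v), since the alternative would make v's neighbours 0 and 4
   equal. *)
have triE v : [/\ E (E (E v 0) 1) 2 = E v 0, E (E v 0) 1 = E v 4 & E (E v 4) 3 = v].
  have := iter_sz (v, E v 0); rewrite (szoutE v 0 isT) [iter _ _ _]/=.
  set w := E v 0; have vE : v = E w 0 by rewrite /w E00.
  rewrite (stepE' _ _ _ vE); set x := E w 1.
  have [j [j5 wE inj outj]] := back w 1 isT.
  rewrite (stepE' _ _ _ wE) => -[vE' wE'].
  (* The triangle closes by turning at [v] from [x] to neighbour 0, and the neighbour before that
     one is number 4. *)
  have x4 : x = E v 4.
    by apply: (@perm_inj _ (turn M v)); rewrite turnE E5 -[RHS]wE' vE'.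
  (* The sizes leave only [j = 2] and [j = 4]. *)
  case: j j5 wE inj outj vE' {wE'} => [|[|[|[|[|j]]]]] //= _ wE _ _ vE'.
    by split=> //; rewrite -x4.
  suff e40 : E v 4 = E v 0 by have := E_inj v 4 0 isT isT e40.
  by rewrite -x4 -[LHS]E00 -[E x 0]E5 vE'.
pose a v := E v 0; pose b v := E v 1.
have b2 v : E (b v) 2 = v by have [] := triE (E v 0); rewrite E00.
have bV v : b (E v 2) = v by have /(_ v) := canF_sym (b2 : cancel b (E ^~ 2)).
(* The face along label 2 is a 4-gon. As label 2 at one end of an edge is label 1 at the other,
   tracing it applies [E ^~ 2] four times. *)
have bi4 v : iter 4 (E ^~ 2) v = v.
  have := iter_sz (v, E v 2); rewrite (szoutE v 2 isT) [iter _ _ _]/=.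
  rewrite !(stepE' _ (E _ 2) 1) ?[E _ 1]bV //; by case.
have biE v : bi b v = E v 2.
  by rewrite -[in LHS](bi4 v) /bi /= !bV.
have ciE v : ci a b v = E v 4 by have [] := triE v.
have c3 v : E (E v 4) 3 = v by have [] := triE v.
have cV v : E (E v 3) 4 = v by have /(_ v) := canF_sym (c3 : cancel (E ^~ 4) (E ^~ 3)).
have ci4 v : iter 4 (E ^~ 4) v = v.
  have := iter_sz (v, E v 4); rewrite (szoutE v 4 isT) [iter _ _ _]/=.
  rewrite !(stepE' _ (E _ 4) 3) ?c3 //; by case.
have cE v : a (bi b v) = E v 3.
  by apply: (can_inj (c3 : cancel (E ^~ 4) (E ^~ 3))); rewrite /= cV -ciE /ci biE /a E00 bV.
have b4 v : iter 4 b v = v by rewrite -[v in iter _ _ v]bi4 /= !bV.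
have act : snub_action a b.
  by split=> // v; rewrite -[RHS]ci4; apply: eq_iter => u; rewrite ciE.
have spk v : spokes a b v = [seq E v i | i <- iota 0 5].
  by rewrite /spokes cE biE ciE.
have adj_spk v : adj M v =i spokes a b v.
  move=> u; rewrite spk; apply/idP/mapP => [/EP[i i5 ->]|[i]].
    by exists i; rewrite // mem_iota.
  by rewrite mem_iota => i5 ->; apply: adjE.
exists a, b; split=> // v; last by rewrite cE biE ciE !turnE E5; split.
rewrite spk map_inj_in_uniq ?iota_uniq // => i j; rewrite !mem_iota.
exact: E_inj.
Qed.

(** * Consequences of simple faces and of polyhedrality *)

Section FreeAction.

Variables (V : finType) (M : rotation_system V) (a b : V -> V).
Hypotheses (torus : torus_map M) (lab : labelled M a b).
Let Us v : uniq (spokes a b v). Proof. by case: lab. Qed.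

Lemma spokes_dart v u : u \in spokes a b v -> (v, u) \in darts M.
Proof. by move=> vu; rewrite (dartsE lab) in_set. Qed.

Lemma spokes_irr v : v \notin spokes a b v.
Proof.
case/and5P: torus => /andP[/forallP irr _] _ _ _ _.
by apply: contra (irr v) => vv; rewrite /adj spokes_dart.
Qed.

(** A fixed point of [f] would be a loop, a fixed point of its square would give a face with two
    darts, and the cube is the inverse of [f]. *)
Lemma uniq_square (f : V -> V) :
  (forall v, iter 4 f v = v) -> (forall v, f v \in spokes a b v) ->
  (forall v, face_at M (v, f v) = [set:: [seq (x, f x) | x <- traject f v 4]]) ->
  forall v, uniq (traject f v 4).
Proof.
move=> f4 fS fF.
have f1 v : v == f v = false by apply: contraNF (spokes_irr v) => /eqP {1}->.
have f2 v : v == f (f v) = false.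
  apply/negP => /eqP ffv; case/and5P: torus => _ _ _ /forall_inP cells _.
  have /andP[+ _] := cells _ (imset_f _ (spokes_dart (fS v))).
  have -> : face_at M (v, f v) = [set (v, f v); (f v, v)].
    rewrite fF /= -!ffv; apply/setP=> d; rewrite !inE.
    by case: (d == _); case: (d == _).
  by rewrite cards2; case: (_ != _).
have f3 v : v == f (f (f v)) = false.
  apply: contraFF (f1 v) => /eqP/(congr1 f) fv.
  by rewrite [f v]fv -[f (f (f (f v)))]/(iter 4 f v) f4.
by move=> v; rewrite /= !inE !f1 !f2 !f3.
Qed.

Lemma labelled_simple_action : simple_action a b.
Proof.
move=> v; rewrite cons_uniq spokes_irr Us /=.
apply/andP; split; apply: uniq_square.
- exact: labelled_bi4 lab.
- by move=> u; rewrite !inE eqxx !orbT.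
- exact: face_at_bi lab.
- by case: lab => -[].
- by move=> u; rewrite !inE eqxx !orbT.
- exact: face_at_ci lab.
Qed.

Hypothesis poly : polyhedral M.

(** Two faces with two common vertices fall under the last case of polyhedrality, so these vertices
    are the ends of the common edge. *)
Lemma shared_edge d d' u w : d \in darts M -> d' \in darts M ->
  face_at M d != face_at M d' -> u != w ->
  {subset [:: u; w] <= face_vertices (face_at M d)} ->
  {subset [:: u; w] <= face_vertices (face_at M d')} ->
  ((u, w) \in face_at M d) && ((w, u) \in face_at M d')
  || ((w, u) \in face_at M d) && ((u, w) \in face_at M d').
Proof.
move=> dM dM' dd' uw sub sub'.
have /forall_inP/(_ _ (imset_f _ dM')) := forall_inP poly _ (imset_f (face_at M) dM).
rewrite dd' /=; set I := _ :&: _.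
have sI : [set u; w] \subset I.
  by apply/subsetP=> x; rewrite !inE => xuw; rewrite sub ?sub' ?inE.
case/orP=> [|/existsP[x /existsP[y /and3P[/eqP I_xy xy yx]]]].
  by rewrite leqNgt; move/subset_leq_card: sI; rewrite cards2 uw => ->.
move: sI; rewrite I_xy => /subsetP sI.
have := sI u; have := sI w; rewrite !inE !eqxx orbT => /(_ isT) + /(_ isT).
case/orP=> /eqP wE /orP[]/eqP uE; move: uw; rewrite wE uE ?eqxx // => _.
  by rewrite xy yx orbT.
by rewrite xy yx.
Qed.

Let ub v : uniq (bsq b v). Proof. by case/and3P: (labelled_simple_action v). Qed.

Let b4 u : b (b (b (b u))) = u. Proof. by case: lab => -[_ h _] _ _ _; exact: h. Qed.

(** A diagonal of a 4-gon is not one of its sides, so by [shared_edge] its ends lie together in no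
    other face. *)
Lemma bsq_diag_notin v d : d \in darts M ->
  face_at M (v, bi b v) != face_at M d ->
  {subset [:: v; b (b v)] <= face_vertices (face_at M d)} -> False.
Proof.
have bb u : bi b (bi b u) = b (b u) by rewrite /bi !b4.
have bib u : bi b (b (b u)) = b u by rewrite /bi b4.
move=> dM ne sub; have := ub v; rewrite /bsq /= !bb !bib !inE !negb_or -!andbA.
case/and4P=> _ vbb vb /andP[bibb _].
have biM : (v, bi b v) \in darts M by rewrite spokes_dart // !inE eqxx !orbT.
have notin x y : y != bi b x -> ((x, y) \in face_at M (v, bi b v)) = false.
  move=> yx; rewrite (face_at_bi lab) inE; apply/mapP => -[z _ [xz yz]].
  by rewrite xz yz eqxx in yx.
have := shared_edge biM dM ne vbb _ sub; rewrite !notin; first 1 last.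
- by rewrite bib.
- by rewrite eq_sym.
rewrite !andFb => h; suff: false by []; apply: h => x.
rewrite (face_at_bi lab) face_vertices_seq !inE.
by rewrite /bsq /= !bb => /orP[]/eqP ->; rewrite eqxx ?orbT.
Qed.

(* Otherwise the 4-gon at v and a triangle at v would share the opposite
   vertices v and b^2 v of the 4-gon. *)
Lemma labelled_a_neq v : a v != b (b v).
Proof.
apply/eqP => av; have aM : (v, a v) \in darts M by rewrite spokes_dart // !inE eqxx.
apply: (bsq_diag_notin (v := v) aM).
  apply/eqP => /(congr1 (fun A : {set _} => #|face_vertices A|)).
  rewrite (face_at_bi lab) (face_at_a lab) !face_vertices_seq !cardsE.
  rewrite (card_uniqP (ub v)) => eq4; have := card_size (tri a b v).
  by rewrite -[#|_|]eq4.
by move=> x; rewrite (face_at_a lab) face_vertices_seq -av !inE => /orP[]->; rewrite ?orbT.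
Qed.

(* Otherwise the two 4-gons at v would share a diagonal. *)
Lemma labelled_c_neq v : ci a b (ci a b v) != b (b v).
Proof.
apply/eqP => cv; have cM : (v, ci a b v) \in darts M by rewrite spokes_dart // !inE eqxx !orbT.
apply: (bsq_diag_notin (v := v) cM).
  apply/eqP=> eqF; have : (v, bi b v) \in face_at M (v, ci a b v) by rewrite -eqF porbit_id.
  rewrite (face_at_ci lab) inE => /mapP[x _ [<- bc]].
  have := Us v; rewrite /spokes bc /= !inE eqxx !orbT !andbF //.
by move=> x; rewrite (face_at_ci lab) face_vertices_seq -cv !inE => /orP[]->; rewrite ?orbT.
Qed.

End FreeAction.

(** * Orbits of p4 and sublattices of the translation lattice *)

Section Model.

(* The number 4 (x r + y) + m stands for the vertex b^m Y^y X^x v0, where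
   X = b b a and Y = b a b are commuting translations with Y^r v0 = v0 and
   X^p v0 = Y^q v0; b acts by m -> m + 1, and a adds 2 to m and moves (x, y) by
   the m-th of the unit vectors (1, 0), (0, 1), (-1, 0), (0, -1). *)
Definition xcoord r i := i %/ 4 %/ r.
Definition ycoord r i := (i %/ 4) %% r.
Definition code r x y m := 4 * (x * r + y) + m.

Definition model_b i := 4 * (i %/ 4) + i.+1 %% 4.
Definition model_a p q r i :=
  let x := xcoord r i in let y := ycoord r i in
  match i %% 4 with
  | 0 => if x.+1 < p then code r x.+1 y 2 else code r 0 ((y + q) %% r) 2
  | 1 => code r x (y.+1 %% r) 3
  | 2 => if 0 < x then code r x.-1 y 0 else code r p.-1 ((y + (r - q)) %% r) 0
  | _ => code r x ((y + r.-1) %% r) 1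
  end.

Definition walk (T : Type) (a b : T -> T) r v i :=
  iter (i %% 4) b (iter (ycoord r i) (fun v => b (a (b v)))
    (iter (xcoord r i) (fun v => b (b (a v))) v)).

(* 1 < r says that (0, 1) is not a period, and the last condition that (1, 0),
   (1, 1) and (1, -1) are not periods. *)
Definition admissible p q r :=
  [&& 0 < p, q < r, 1 < r & (p == 1) ==> (q \notin [:: 0; 1; r.-1])].

Lemma codeK r x y m : y < r -> m < 4 ->
  [/\ xcoord r (code r x y m) = x, ycoord r (code r x y m) = y
    & code r x y m %% 4 = m].
Proof.
move=> yr m4; have r0 : 0 < r by case: r yr.
have c4 : code r x y m %/ 4 = x * r + y by rewrite /code; lia.
rewrite /xcoord /ycoord c4 divnMDl // modnMDl divn_small // modn_small // addn0.
by split=> //; rewrite /code; lia.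
Qed.

Lemma coordK r i : i = code r (xcoord r i) (ycoord r i) (i %% 4).
Proof. by rewrite /code -divn_eq mulnC -divn_eq. Qed.

Lemma coord_lt p r i : i < 4 * p * r -> [/\ xcoord r i < p, ycoord r i < r & 0 < p].
Proof.
move=> ipr; have /andP[p0 r0] : (0 < p) && (0 < r).
  by move: (leq_ltn_trans (leq0n i) ipr); rewrite !muln_gt0 => /andP[/andP[_ ->] ->].
by rewrite /xcoord /ycoord ltn_mod r0 !ltn_divLR //; split=> //; lia.
Qed.

Lemma model_a_lt p q r i : i < 4 * p * r -> model_a p q r i < 4 * p * r.
Proof.
case/coord_lt=> xp yr p0; have r0 : 0 < r by case: r yr {xp}.
have code_lt x y m : x < p -> y < r -> m < 4 -> code r x y m < 4 * p * r.
  move=> xp' yr' m4'; have : x.+1 * r <= p * r by rewrite leq_mul2r xp' orbT.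
  by rewrite /code; lia.
have m4 : i %% 4 < 4 by rewrite ltn_mod.
rewrite /model_a; case: (i %% 4) m4 => [|[|[|[|]]]] // _.
- by case: (ltnP (xcoord r i).+1 p) => xp'; rewrite code_lt ?ltn_mod.
- by rewrite code_lt ?ltn_mod.
- case: (ltnP 0 (xcoord r i)) => xp'; rewrite code_lt ?ltn_mod //; last by rewrite prednK.
  by apply: leq_ltn_trans (leq_pred _) xp.
by rewrite code_lt ?ltn_mod.
Qed.

Lemma model_b_lt p r i : i < 4 * p * r -> model_b i < 4 * p * r.
Proof. by rewrite /model_b -mulnA; lia. Qed.

Lemma walk_code (T : Type) (a b : T -> T) r v x y m : y < r -> m < 4 ->
  walk a b r v (code r x y m) =
  iter m b (iter y (fun v => b (a (b v))) (iter x (fun v => b (b (a v))) v)).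
Proof. by move=> yr m4; rewrite /walk; have [-> -> ->] := codeK x yr m4. Qed.

End Model.

(** * The translations X and Y in the group p4 *)

Section Translations.

Variables (gT : finGroupType) (A B : gT).
(** Permutations are multiplied from left to right, so this acts as [v |-> b (b (a v))]. *)
Let X := (A * B * B)%g.
Let Y := (B * A * B)%g.

Lemma translation_rot1 : (B * X = Y * B)%g.
Proof. by rewrite /X /Y !mulgA. Qed.

Hypotheses (AA : (A * A = 1)%g) (B4 : (B ^+ 4 = 1)%g).
Hypothesis C4 : ((A * B) ^+ 4 = 1)%g.

Let B3 : (B * B * B = B^-1)%g.
Proof. by apply: (mulIg B); rewrite mulVg -B4 !expgS expg0 mulg1 !mulgA. Qed.

Lemma translationV : (X^-1 = B * B * A)%g.
Proof.
apply/eqP; rewrite eq_invg_mul /X !mulgA; apply/eqP.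
by rewrite -(mulgA A) -(mulgA A) B3 -!mulgA (mulgA B^-1%g) mulVg mul1g.
Qed.

Lemma translation_rot2 : (B * Y = X^-1 * B)%g.
Proof. by rewrite translationV /Y !mulgA. Qed.

(** This says that the square of [B * A] is its own inverse; [B * A] is conjugate to [A * B]. *)
Lemma rot_conj : (B * A * B * A = A * B^-1 * A * B^-1)%g.
Proof.
apply: (mulgI A); apply: (mulIg (B * A * B)%g); rewrite !mulgA AA mul1g mulgKV.
by rewrite -[in RHS](mulgA _ A A) AA mulg1 mulVg -C4 !expgS expg0 mulg1 !mulgA.
Qed.

Lemma translation_commute : commute X Y.
Proof.
rewrite /commute /X /Y !mulgA.
transitivity (A * B^-1 * A * B)%g; first by rewrite -B3 !mulgA.
by rewrite rot_conj mulgKV.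
Qed.

End Translations.

(** * Coordinates on the vertices by translations and rotations *)

Section Lattice.
Import GroupScope.
Local Open Scope nat_scope.

Variables (V : finType) (a b : V -> V) (v0 : V).
Hypothesis act : snub_action a b.
Hypothesis a_free : forall v, a v != v.
Hypothesis b2_free : forall v, b (b v) != v.
Hypothesis c2_free : forall v, ci a b (ci a b v) != v.
Hypothesis ab2_neq : forall v, a v != b (b v).
Hypothesis cb2_neq : forall v, ci a b (ci a b v) != b (b v).
Hypothesis transitive : forall P : pred V, P v0 ->
  (forall v, P v -> P (a v)) -> (forall v, P v -> P (b v)) -> forall v, P v.

Let aK v : a (a v) = v. Proof. by case: act. Qed.
Let b4 v : b (b (b (b v))) = v. Proof. by case: act => _ h _; exact: h. Qed.
Let b_inj : injective b. Proof. by apply: (@can_inj _ _ _ (bi b)) => v; exact: b4. Qed.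

Let A : {perm V} := perm (can_inj aK).
Let B : {perm V} := perm b_inj.
Let X : {perm V} := (A * B * B)%g.
Let Y : {perm V} := (B * A * B)%g.

Let AA : (A * A = 1)%g. Proof. by apply/permP => v; rewrite permM !permE. Qed.
Let B4 : (B ^+ 4 = 1)%g.
Proof. by apply/permP => v; rewrite permX perm1 /= !permE. Qed.
Let C4 : ((A * B) ^+ 4 = 1)%g.
Proof.
apply/permP => v; rewrite permX perm1 /= !permM !permE.
by case: act => _ _ h; exact: h.
Qed.
Let XY : commute X Y := translation_commute AA B4 C4.
Let BX : (B * X = Y * B)%g := translation_rot1 A B.
Let BY : (B * Y = X^-1 * B)%g := translation_rot2 AA B4.

Let T : {group {perm V}} := [group of <[X]> <*> <[Y]>]%G.

Let cXY : (<[Y]> \subset 'C(<[X]>))%g.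
Proof. by rewrite cent_cycle cycle_subG; apply/cent1P; apply: commute_sym. Qed.

Lemma transP t : reflect (exists i j, t = X ^+ i * Y ^+ j)%g (t \in T).
Proof.
rewrite /= cent_joinEr //; apply: (iffP mulsgP).
  by case=> x y /cycleP[i ->] /cycleP[j ->] ->; exists i, j.
by case=> i [j ->]; exists (X ^+ i)%g (Y ^+ j)%g; rewrite ?mem_cycle.
Qed.

Lemma trans_commute s t : s \in T -> t \in T -> commute s t.
Proof.
have /centsP cT : abelian T by rewrite /= abelianY !cycle_abelian.
by move=> sT tT; apply: cT.
Qed.

Let TX : X \in T. Proof. by rewrite mem_gen // inE cycle_id. Qed.
Let TY : Y \in T. Proof. by rewrite mem_gen // inE cycle_id orbT. Qed.

Let XJ : (X ^ B^-1 = Y)%g. Proof. by rewrite conjgE invgK mulgA BX mulgK. Qed.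
Let YJ : (Y ^ B^-1 = X^-1)%g. Proof. by rewrite conjgE invgK mulgA BY mulgK. Qed.

Lemma trans_conj t k : t \in T -> (t ^ B ^- k \in T)%g.
Proof.
have rot1 s : s \in T -> (s ^ B^-1 \in T)%g.
  case/transP=> i [j ->]; rewrite conjMg !conjXg XJ YJ.
  by rewrite groupM ?groupX ?groupV.
move=> tT; elim: k => [|k IHk]; first by rewrite invg1 conjg1.
by rewrite expgS invgM conjgM rot1.
Qed.

(** Conjugation by a quarter turn sends X to Y and Y to the inverse of X, so doing it twice inverts
    every translation. *)
Lemma trans_half_turn t : t \in T -> (B ^+ 2 * t = t^-1 * B ^+ 2)%g.
Proof.
move=> tT; apply: (mulIg (B ^- 2)%g); rewrite mulgK -mulgA.
suff <- : (t ^ B ^- 2 = t^-1)%g by rewrite conjgE invgK.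
case/transP: tT => i [j ->].
have -> : (B ^- 2 = B^-1 * B^-1)%g by rewrite -invgM.
rewrite conjgM (conjMg (X ^+ i)%g) !conjXg XJ YJ (conjMg (Y ^+ i)%g) !conjXg YJ conjVg XJ.
by rewrite [RHS]invgM !expgVn; apply: trans_commute; rewrite groupV groupX.
Qed.

Let XE v : X v = b (b (a v)). Proof. by rewrite !permM !permE. Qed.
Let YE v : Y v = b (a (b v)). Proof. by rewrite !permM !permE. Qed.
Let BE k v : (B ^+ k)%g v = iter k b v.
Proof. by rewrite permX; apply: eq_iter => u; rewrite permE. Qed.

Let conj_free (s g : {perm V}) : (forall v, g v != v) -> forall v, (g ^ s)%g v != v.
Proof.
move=> gfree v; apply: contraNneq (gfree (s^-1 v)%g) => e.
by rewrite -{2}e conjgE !permM permK.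
Qed.

(* Modulo squares of translations t is 1, X, Y or X Y, so t B^2 is conjugate to
   B^2, to A, or to the inverse of (A B)^2. *)
Lemma half_turn_free t v : t \in T -> (t * B ^+ 2)%g v != v.
Proof.
case/transP=> i [j ->].
pose s := (X ^+ i./2 * Y ^+ j./2)%g; pose u := (X ^+ odd i * Y ^+ odd j)%g.
have sT : s \in T by rewrite groupM ?groupX.
have uT : u \in T by rewrite groupM ?groupX.
have -> : (X ^+ i * Y ^+ j = s * u * s)%g.
  have XYh k l : commute (Y ^+ k)%g (X ^+ l)%g.
    exact: trans_commute (groupX _ TY) (groupX _ TX).
  rewrite (trans_commute sT uT) /s /u -{1}[i]odd_double_half -{1}[j]odd_double_half.
  rewrite -!addnn !expgD; move: (X ^+ odd i)%g (Y ^+ odd j)%g (X ^+ i./2)%g (Y ^+ j./2)%g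
    (XYh (odd j) i./2) (XYh j./2 i./2) => x1 y1 x y c1 c.
  rewrite !mulgA -(mulgA x1 y1 x) c1 !mulgA -(mulgA _ y x) c !mulgA.
  by rewrite -(mulgA _ y1 x) c1 !mulgA.
have -> : (s * u * s * B ^+ 2 = (u * B ^+ 2) ^ s^-1)%g.
  have := trans_half_turn (groupVr sT); rewrite invgK => h.
  by rewrite conjgE invgK -(mulgA u) h !mulgA.
apply: conj_free => {v} v; rewrite permM BE /u permM /=.
case: (odd i); case: (odd j); rewrite ?expg0 ?expg1 ?perm1 ?XE ?YE ?b4.
- apply: contraNneq (c2_free (b v)) => /(congr1 b); rewrite b4 => /(congr1 a).
  rewrite aK => /(congr1 b); rewrite b4 => /(congr1 a); rewrite aK /ci => e.
  by rewrite -e.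
- exact: a_free.
- apply: contraNneq (a_free (b v)) => /(congr1 b).
  by rewrite b4 => ->.
exact: b2_free.
Qed.

(** For odd [k] the square of the rotation is a half turn composed with a translation, and it
    inherits the fixed points. *)
Lemma rotation_free t k v : t \in T -> ~~ (4 %| k) -> (t * B ^+ k)%g v != v.
Proof.
move=> tT k4; have Bmod m : (B ^+ m = B ^+ (m %% 4))%g.
  by rewrite {1}(divn_eq m 4) expgD mulnC expgM B4 expg1n mul1g.
have sq : (t * B ^+ k * (t * B ^+ k) = t * t ^ B ^- k * B ^+ (k + k))%g.
  by rewrite conjgE invgK expgD !mulgA mulgVK.
have tt'T : (t * t ^ B ^- k)%g \in T by rewrite groupM ?trans_conj.
case kodd: (odd k); last first.
  have e : k %% 4 = 2 by lia.
  by rewrite Bmod e half_turn_free.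
apply: contraNneq (half_turn_free v tt'T) => e.
have <- : (k + k) %% 4 = 2 by lia.
by rewrite -Bmod -sq permM !e.
Qed.

Lemma X_free v : X v != v.
Proof.
rewrite XE; apply: contraNneq (ab2_neq v) => e.
by rewrite -{2}e b4.
Qed.

Lemma Y_free v : Y v != v.
Proof.
by rewrite YE; apply: contraNneq (X_free (b v)) => e; rewrite XE e.
Qed.

(** By the relation of order four for [b a], a fixed point would make the squares of [ci] and [b]
    agree at [b v], so that two 4-gons share a diagonal. *)
Lemma XY_free v : Y (X v) != v.
Proof.
have ab4 u : a (b (a (b (a (b (a (b u))))))) = u.
  by apply: b_inj; case: act => _ _ h; exact: (h (b u)).
rewrite YE XE; apply: contraNneq (cb2_neq (b v)) => e; apply/eqP; rewrite /ci.
have <- : b (b (b (a (b (b (b (a v))))))) = a (b (a (b v))).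
  by rewrite -[LHS]ab4 b4 aK b4 aK.
by rewrite e.
Qed.

(** A quarter turn takes (1, -1) to (1, 1): if [X v = Y v], then [Y (X (b v)) = b v]. *)
Lemma XY_neq v : X v != Y v.
Proof.
rewrite XE YE (inj_eq b_inj); apply: contraNneq (XY_free (b v)) => e.
by rewrite YE XE -e b4 aK.
Qed.

Let r := #|porbit Y v0|.
Let P x y := (X ^+ x * Y ^+ y)%g v0.
Let phi x y m := iter m b (P x y).

Let r_gt0 : 0 < r. Proof. by rewrite lt0n card_porbit_neq0. Qed.
Let Yr : (Y ^+ r)%g v0 = v0. Proof. by rewrite permX iter_porbit. Qed.
Let PS x y : Y (P x y) = P x y.+1. Proof. by rewrite /P expgSr mulgA [RHS]permM. Qed.
Let Pmod x y : P x (y %% r) = P x y.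
Proof.
have E k : (Y ^+ (k * r))%g v0 = v0.
  by elim: k => [|k IHk]; rewrite ?perm1 // mulSn expgD permM Yr.
have cXY' k : (X ^+ x * Y ^+ k = Y ^+ k * X ^+ x)%g by apply: trans_commute; rewrite groupX.
by rewrite /P !cXY' !permM {2}(divn_eq y r) expgD permM E.
Qed.

Let walkE x y m : y < r -> m < 4 -> walk a b r v0 (code r x y m) = phi x y m.
Proof.
move=> yr m4; rewrite walk_code // /phi /P permM !permX; congr (iter m b _).
have -> : iter x X v0 = iter x (fun v => b (b (a v))) v0 by apply: eq_iter.
by apply: eq_iter => u; rewrite YE.
Qed.

Lemma porbit_X_exists : exists p, (0 < p) && ((X ^+ p)%g v0 \in porbit Y v0).
Proof. by exists #[X]; rewrite order_gt0 expg_order perm1 porbit_id. Qed.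

Let XP x y : X (P x y) = P x.+1 y.
Proof.
have cX : commute (X ^+ x * Y ^+ y)%g X.
  by apply: trans_commute; rewrite // groupM ?groupX.
by rewrite /P -permM cX mulgA -expgS.
Qed.

(** Since [a] is X followed by a half turn, moving X past [m] quarter turns yields the unit step in
    direction [m]. Leaving the range of [x] is repaired by [X^p v0 = Y^q v0], that of [y] by
    [Y^r v0 = v0]. *)
Lemma model_a_phi p q x y m :
  0 < p -> (forall y, P p y = P 0 (q + y)) -> q < r -> x < p -> y < r -> m < 4 ->
  a (phi x y m) = walk a b r v0 (model_a p q r (code r x y m)).
Proof.
move=> p0 Pp qr xp yr m4; have [xE yE mE] := codeK x yr m4.
have md k : k %% r < r by rewrite ltn_mod.
have aE u : a u = b (b (X u)) by rewrite XE b4.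
have Xa u : X (a (b (b u))) = u by rewrite XE aK b4.
rewrite /model_a xE yE mE; case: m m4 {xE yE mE} => [|[|[|[|m]]]] // _.
- rewrite aE XP; case: ltnP => [xp'|px]; first by rewrite walkE.
  have -> : x.+1 = p by apply/eqP; rewrite eqn_leq xp.
  by rewrite walkE // /phi Pmod Pp addnC.
- by rewrite walkE // /phi Pmod -PS YE /= b4.
(* Backward steps are checked after applying the injective X, and Y in the last case, to both
   sides. *)
- case: x xp => [|x] xp /=; last by rewrite walkE //; apply: (@perm_inj _ X); rewrite Xa XP.
  rewrite walkE // /phi Pmod; apply: (@perm_inj _ X); rewrite Xa XP prednK // Pp.
  by rewrite addnCA subnKC 1?ltnW // -(Pmod 0 (y + r)) modnDr Pmod.
rewrite walkE // /phi Pmod [iter 1 _ _]/=.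
have -> : P x (y + r.-1) = b (b (b (a (b (b (b (P x y))))))) by
  apply: (@perm_inj _ Y); rewrite PS [RHS]YE !b4 aK b4 -addnS prednK //;
  by rewrite -(Pmod x (y + r)) modnDr Pmod.
by rewrite b4.
Qed.

(** If the first coordinates differed, a power of X with exponent between 0 and [p] would bring [v0]
    back into its Y-orbit. *)
Lemma P_inj p x y x' y' :
  (forall d, 0 < d -> (X ^+ d)%g v0 \in porbit Y v0 -> p <= d) ->
  x < p -> x' < p -> y < r -> y' < r -> P x y = P x' y' -> (x, y) = (x', y').
Proof.
move=> p_min xp xp' yr yr'.
have Yy k w : porbit Y ((Y ^+ k)%g w) = porbit Y w by apply: porbit_perm.
have Pcomm k l : P k l = (Y ^+ l * X ^+ k)%g v0.
  by congr (fun_of_perm _ v0); apply: trans_commute; rewrite groupX.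
wlog xx' : x x' y y' xp xp' yr yr' / x <= x'.
  move=> W; case/orP: (leq_total x x') => le e; first exact: W e.
  by apply/esym/W.
rewrite !Pcomm -{1}(subnK xx') expgD mulgA !permM => /perm_inj.
rewrite -permM => e; have Xd : (X ^+ (x' - x))%g v0 \in porbit Y v0.
  rewrite -eq_porbit_mem -(Yy y') -permM.
  rewrite (trans_commute (s := X ^+ _) (t := Y ^+ _))%g ?groupX // -e Yy //.
have d0 : x' - x = 0.
  apply/eqP; apply: contraTT xp'; rewrite -leqNgt -lt0n => d0.
  exact: leq_trans (p_min _ d0 Xd) (leq_subr _ _).
have -> : x = x' by apply/eqP; rewrite eqn_leq xx' -subn_eq0 d0.
move: e; rewrite d0 mulg1 !permX => e; congr (_, _); apply/eqP.
rewrite -(nth_uniq v0 _ _ (uniq_traject_porbit Y v0)) ?size_traject //.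
by rewrite !nth_traject // e.
Qed.

(** With different [m] a translation followed by a nontrivial rotation would fix [v0], against
    [rotation_free]. *)
Lemma phi_inj p x y m x' y' m' :
  (forall d, 0 < d -> (X ^+ d)%g v0 \in porbit Y v0 -> p <= d) ->
  x < p -> x' < p -> y < r -> y' < r -> m < 4 -> m' < 4 ->
  phi x y m = phi x' y' m' -> [/\ x = x', y = y' & m = m'].
Proof.
move=> p_min xp xp' yr yr'.
wlog mm' : x x' y y' m m' xp xp' yr yr' / m' <= m.
  move=> W m4 m4'; case/orP: (leq_total m' m) => le e; first exact: W e.
  by case: (W _ _ _ _ _ _ _ _ _ _ le m4' m4 (esym e)).
move=> m4 _; rewrite /phi -(subnKC mm') iterD => e.
have {}e : iter (m - m') b (P x y) = P x' y'.
  have iter_inj k : injective (iter k b) by elim: k => //= k IHk u v /b_inj/IHk.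
  exact: iter_inj e.
case: (posnP (m - m')) e => [-> /= e|k0].
  by have [-> ->] := P_inj p_min xp xp' yr yr' e; split; rewrite ?addn0.
rewrite -BE /P -permM => e; set k := m - m' in k0 e.
have k4 : ~~ (4 %| k) by rewrite /k; apply/negP => /dvdn_leq; lia.
have T' : (X ^+ x * Y ^+ y)%g \in T by rewrite groupM ?groupX.
have T'' : (X ^+ x' * Y ^+ y')%g \in T by rewrite groupM ?groupX.
have := rotation_free v0 (groupM T' (trans_conj k (groupVr T''))) k4.
rewrite conjgE invgK !mulgA mulgVK permM e -permM mulgV perm1 eqxx //.
Qed.

(** The triple is the Hermite normal form of the lattice of periods, with [p] the least positive
    exponent bringing [v0] back to its Y-orbit. The image of [walk] contains [v0] and is closed
    under [a] and [b], so it is everything; injectivity then gives the number of vertices. *)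
Lemma lattice_walk : exists p q k, let phi := walk a b k v0 in
  [/\ admissible p q k, 4 * p * k = #|V|, {in gtn #|V| &, injective phi}
    & forall i, i < #|V| ->
      a (phi i) = phi (model_a p q k i) /\ b (phi i) = phi (model_b i)].
Proof.
case: (ex_minnP porbit_X_exists) => p /andP[p0]; rewrite porbit_traject => /trajectP[q qr].
rewrite -/r -permX => Xp p_min.
have Pp y : P p y = P 0 (q + y) by rewrite /P expg0 mul1g permM Xp -permM -expgD.
have p_min' d : 0 < d -> (X ^+ d)%g v0 \in porbit Y v0 -> p <= d.
  by move=> d0 dY; apply: p_min; rewrite d0.
have coords i : i < 4 * p * r -> [/\ xcoord r i < p, ycoord r i < r & i %% 4 < 4].
  by case/coord_lt=> xp yr _; rewrite ltn_mod.
have walkE' i : walk a b r v0 i = phi (xcoord r i) (ycoord r i) (i %% 4).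
  by rewrite {1}(coordK r i) walkE // /ycoord ltn_mod.
have step i : i < 4 * p * r ->
    a (walk a b r v0 i) = walk a b r v0 (model_a p q r i)
    /\ b (walk a b r v0 i) = walk a b r v0 (model_b i).
  move=> ipr; have [xp yr m4] := coords i ipr; split.
    by rewrite walkE' (model_a_phi p0 Pp qr xp yr m4) -coordK.
  have -> : model_b i = code r (xcoord r i) (ycoord r i) ((i %% 4).+1 %% 4).
    by rewrite /code -divn_eq /model_b; lia.
  rewrite walkE' walkE ?ltn_mod //.
  by case: (i %% 4) m4 => [|[|[|[|]]]] //= _; rewrite /phi /= b4.
have winj : {in gtn (4 * p * r) &, injective (walk a b r v0)}.
  move=> i j; rewrite !inE => /coords[xi yi mi] /coords[xj yj mj].
  rewrite !walkE' => /(phi_inj p_min' xi xj yi yj mi mj) [ex ey em].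
  by rewrite (coordK r i) (coordK r j) ex ey em.
have surj v : exists2 i, i < 4 * p * r & walk a b r v0 i = v.
  have a_lt i : i < 4 * p * r -> model_a p q r i < 4 * p * r by exact: model_a_lt.
  have b_lt i : i < 4 * p * r -> model_b i < 4 * p * r by exact: model_b_lt.
  suff /existsP[i /eqP <-] : [exists i : 'I_(4 * p * r), walk a b r v0 i == v] by exists i.
  move: v; apply: transitive => [|v /existsP[i /eqP <-]|v /existsP[i /eqP <-]].
  - have n0 : 0 < 4 * p * r by rewrite !muln_gt0 p0 r_gt0.
    by apply/existsP; exists (Ordinal n0); rewrite /walk /xcoord /ycoord !div0n !mod0n.
  - rewrite (step i _).1 //; apply/existsP; by exists (Ordinal (a_lt i (ltn_ord i))).
  rewrite (step i _).2 //; apply/existsP; by exists (Ordinal (b_lt i (ltn_ord i))).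
have cardV : 4 * p * r = #|V|; last first.
  exists p, q, r; rewrite -cardV; split=> //.
  apply/and4P; split=> //.
  + rewrite ltn_neqAle r_gt0 andbT eq_sym; apply: contraNneq (Y_free v0) => r1.
    by rewrite -{2}Yr r1.
  (* The values 0, 1 and [r.-1] of [q] would make (1, 0), (1, -1) and (1, 1) periods. *)
  apply/implyP=> /eqP p1; move: Xp; rewrite p1 expg1 !inE => Xq.
  apply/negP => /or3P[]/eqP eq; move: Xq; rewrite eq.
  + by rewrite perm1 => /eqP; rewrite (negPf (X_free v0)).
  + by rewrite expg1 => /eqP; rewrite (negPf (XY_neq v0)).
  move/(congr1 Y) => XYq; move/eqP: (XY_free v0); apply.
  by rewrite XYq -permM -expgSr prednK.
have f_inj : injective (fun i : 'I_(4 * p * r) => walk a b r v0 i).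
  by move=> i j /winj e; apply: val_inj; apply: e; exact: ltn_ord.
rewrite -[LHS]card_ord -(card_codom f_inj); apply: eq_card => v; apply/codomP.
by have [i ipr <-] := surj v; exists (Ordinal ipr).
Qed.

End Lattice.

(** * Maps as relabelled lattice quotients *)

Definition snub_faces (V : finType) (a b : V -> V) : {set {set V}} :=
  [set A | [exists v, [|| A == [set:: tri a b v], A == [set:: bsq b v]
                        | A == [set:: csq a b v]]]].

Lemma snub_facesP (V : finType) (a b : V -> V) A : reflect
  (exists v, [\/ A = [set:: tri a b v], A = [set:: bsq b v] | A = [set:: csq a b v]])
  (A \in snub_faces a b).
Proof.
rewrite inE; apply: (iffP existsP) => -[v Av]; exists v.
  by case/or3P: Av => /eqP; constructor.
by case: Av => ->; rewrite eqxx ?orbT.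
Qed.

Lemma face_vertex_sets_snub (V : finType) (M : rotation_system V) a b :
  labelled M a b -> face_vertex_sets M = snub_faces a b.
Proof.
move=> lab; apply/setP=> A.
exact/(face_vertex_sets_labelled lab)/snub_facesP.
Qed.

Lemma imset_seq (V W : finType) (f : V -> W) (s : seq V) :
  f @: [set:: s] = [set:: map f s].
Proof.
apply/setP=> y; rewrite inE; apply/imsetP/mapP => -[x]; last by exists x; rewrite ?inE.
by rewrite inE; exists x.
Qed.

Lemma snub_faces_relabel (V : finType) (a b a' b' : V -> V) (s : {perm V}) :
  (forall v, a (s v) = s (a' v)) -> (forall v, b (s v) = s (b' v)) ->
  snub_faces a b = [set s @: A | A : {set V} in snub_faces a' b'].
Proof.
move=> sa sb.
have sbi v : bi b (s v) = s (bi b' v) by rewrite /bi !sb.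
have sci v : ci a b (s v) = s (ci a' b' v) by rewrite /ci sa sb.
have st v : [set:: tri a b (s v)] = s @: [set:: tri a' b' v].
  by rewrite imset_seq /tri /= sa sci.
have sq f f' : (forall v, f (s v) = s (f' v)) ->
    forall v, [set:: traject f (s v) 4] = s @: [set:: traject f' v 4].
  by move=> ff v; rewrite imset_seq /= !ff.
have sbE v : [set:: bsq b (s v)] = s @: [set:: bsq b' v] by exact: sq.
have scE v : [set:: csq a b (s v)] = s @: [set:: csq a' b' v] by exact: sq.
apply/setP=> A; apply/snub_facesP/imsetP.
  case=> v; rewrite -(permKV s v) st sbE scE => Av.
  by case: Av => ->; [exists [set:: tri a' b' (s^-1%g v)]|exists [set:: bsq b' (s^-1%g v)]
    |exists [set:: csq a' b' (s^-1%g v)]] => //; apply/snub_facesP; exists (s^-1%g v); constructor.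
case=> A' /snub_facesP[v Av] ->; exists (s v).
by rewrite st sbE scE; case: Av => ->; constructor.
Qed.

Section OrdinalModel.

Variable n : nat.
Notation V := 'I_n.+1.

Definition ord_a p q r (i : V) : V := inZp (model_a p q r i).
Definition ord_b (i : V) : V := inZp (model_b i).

Lemma labelled_relabel (M : rotation_system V) :
  M \in snub_square_torus_maps n.+1 -> exists p q r (s : {perm V}),
  [/\ admissible p q r, 4 * p * r = n.+1 &
    face_vertex_sets M
      = [set s @: A | A : {set V} in snub_faces (@ord_a p q r) ord_b]].
Proof.
rewrite inE => /and3P[torus poly semi].
have [a [b lab]] := labelled_of_sizes torus semi.
have simp := labelled_simple_action torus lab; have [act _ adjE _] := lab.
have a_free v : a v != v.
  by have /and3P[] := simp v; rewrite /= !inE !negb_or eq_sym -!andbA => /andP[].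
have sq_free f v : uniq (traject f v 4) -> f (f v) != v.
  by rewrite /= !inE !negb_or eq_sym [v == f (f v)]eq_sym -!andbA => /and3P[].
have b4 v : b (b (b (b v))) = v by case: act => _ h _; exact: h.
have b2_free v : b (b v) != v.
  by have /and3P[_ /sq_free + _] := simp v; rewrite /bi !b4.
have c2_free v : ci a b (ci a b v) != v by have /and3P[_ _ /sq_free] := simp v.
(* Connectedness gives transitivity, every spoke being a word in [a] and [b] applied to its
   centre. *)
have trans (P : pred V) : P ord0 -> (forall v, P v -> P (a v)) ->
    (forall v, P v -> P (b v)) -> forall v, P v.
  move=> P0 Pa Pb v; case/and5P: torus => _ /andP[_ conn] _ _ _.
  have /connectP[s ps ->] := forallP (forallP conn ord0) v.
  elim: s ord0 P0 ps => //= w s IHs u Pu /andP[uw]; apply: IHs.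
  have : w \in adj M u by [].
  rewrite adjE !inE => /or4P[/eqP->|/eqP->|/eqP->|/orP[]/eqP->]; rewrite /bi /ci; by auto.
have [p [q [r [adm card phi_inj phiE]]]] := lattice_walk act a_free b2_free c2_free
  (labelled_a_neq torus lab poly) (labelled_c_neq torus lab poly) trans.
rewrite card_ord in card phi_inj phiE; set phi := walk a b r ord0 in phi_inj phiE.
have s_inj : injective (fun i : V => phi i).
  by move=> i j /phi_inj e; apply: val_inj; apply: e; rewrite inE.
exists p, q, r, (perm s_inj); split=> //.
rewrite (face_vertex_sets_snub lab); apply: snub_faces_relabel => v; rewrite !permE /=.
  have lt_n : v < 4 * p * r by rewrite card.
  by rewrite (phiE v _).1 // modn_small // (leq_trans (model_a_lt q lt_n)) ?card.
have lt_n : v < 4 * p * r by rewrite card.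
by rewrite (phiE v _).2 // modn_small // (leq_trans (model_b_lt lt_n)) ?card.
Qed.

End OrdinalModel.

(** * Lattice quotients as polyhedral maps *)

Section Existence.

Variables (V : finType) (a b : V -> V).
Hypotheses (act : snub_action a b) (simp : simple_action a b).

Let Us v : uniq (spokes a b v).
Proof. by have /and3P[/andP[]] := simp v. Qed.

Lemma labelled_exists : exists M, labelled M a b.
Proof.
have turnP v : exists t : {perm V}, [/\ t (a v) = b v, t (b v) = bi b v,
    t (bi b v) = a (bi b v), t (a (bi b v)) = ci a b v & t (ci a b v) = a v].
  (* The rotation at [v] is the cyclic successor in the duplicate-free list of spokes. *)
  exists (perm (can_inj (prev_next (Us v)))); rewrite !permE.
  have nx i : i < 5 -> next (spokes a b v) (nth v (spokes a b v) i)
      = nth (a v) (behead (spokes a b v)) i.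
    by move=> i5; rewrite next_nth mem_nth // index_uniq.
  by split; [exact: (nx 0)|exact: (nx 1)|exact: (nx 2)|exact: (nx 3)|exact: (nx 4)].
have /fin_all_exists[t tP] := turnP.
exists ([set d | d.2 \in spokes a b d.1], finfun t); split=> //.
  by move=> v u; rewrite /adj inE -topredE /= inE.
by move=> v; rewrite /turn ffunE.
Qed.

End Existence.

(** Polyhedrality for two faces given by their dart lists, in a form that can be evaluated. A common
    dart means that the faces are equal, as they are orbits; otherwise at most one common vertex is
    listed, or all of them are ends of an edge that the faces traverse oppositely. *)
Definition edge_compatible (T : eqType) (s t : seq (T * T)) : bool :=
  has [in t] s ||
  let I := [seq x <- map fst s | x \in map fst t] in
  (size I <= 1) ||
  has (fun d => [&& (d.2, d.1) \in t, d.1 \in I, d.2 \in I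
                  & all (pred2 d.1 d.2) I]) s.

Definition face_darts (T : eqType) (a b : T -> T) v :=
  [:: tri_darts a b v; bsq_darts b v; csq_darts a b v].

(** * Simple labelled actions give torus maps of the right type *)

Section Validity.

Variables (V : finType) (a b : V -> V) (M : rotation_system V).
Hypotheses (lab : labelled M a b) (simp : simple_action a b).

Let aK v : a (a v) = v. Proof. by case: lab => -[]. Qed.
Let b4 v : b (b (b (b v))) = v. Proof. by case: lab => -[_ h _] _ _ _; exact: h. Qed.
Let ciK v : a (bi b (ci a b v)) = v. Proof. by rewrite /ci /bi b4. Qed.
Let cK v : ci a b (a (bi b v)) = v. Proof. by rewrite /ci aK b4. Qed.
Let Us v : uniq (spokes a b v). Proof. by have /and3P[/andP[]] := simp v. Qed.
Let adjE v : adj M v =i spokes a b v. Proof. by case: lab. Qed.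

Let adjC u v : adj M u v -> adj M v u.
Proof.
have -> : adj M u v = (v \in spokes a b u) by rewrite -adjE.
have -> : adj M v u = (u \in spokes a b v) by rewrite -adjE.
rewrite !inE => /or4P[/eqP->|/eqP->|/eqP->|/orP[]/eqP->].
- by rewrite aK eqxx.
- by rewrite /bi b4 eqxx !orbT.
- by rewrite {2}/bi b4 eqxx !orbT.
- by rewrite cK eqxx !orbT.
by rewrite ciK eqxx !orbT.
Qed.

Lemma labelled_simple_graph : simple_graph M.
Proof.
apply/andP; split.
  apply/forallP=> v; have /and3P[/andP[+ _] _ _] := simp v.
  by rewrite -(adjE v v).
by apply/'forall_'forall_implyP => u v; exact: adjC.
Qed.

Lemma labelled_cyclic_rotations : cyclic_rotations M.
Proof.
have [_ _ _ turns] := lab.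
have E v : porbit (turn M v) (a v) = nbhd M v.
  have [t0 t1 t2 t3 t4] := turns v.
  rewrite (@porbit_traject_period _ _ _ 5) //=; last by rewrite t0 t1 t2 t3 t4.
  by apply/setP=> u; rewrite [RHS]inE -[adj M v u]/(u \in adj M v) adjE inE t0 t1 t2 t3.
apply/forallP=> v; apply/forall_inP=> u; rewrite -E => uv; by rewrite eq_porbit_mem.
Qed.

Let nbhd_spokes v : nbhd M v = [set:: spokes a b v].
Proof. by apply/setP=> u; rewrite !in_set -adjE. Qed.

Let utri v : uniq (tri a b v).
Proof.
have /and3P[U _ _] := simp v.
move: U; rewrite /spokes /tri /= !inE !negb_or -!andbA.
by move=> /and5P[-> _ _ _ /and5P[-> _ _ _ /andP[-> _]]].
Qed.
Let ubsq v : uniq (bsq b v). Proof. by have /and3P[] := simp v. Qed.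
Let ucsq v : uniq (csq a b v). Proof. by have /and3P[] := simp v. Qed.

Let card_face (s : seq (V * V)) : uniq (map fst s) ->
  #|[set:: s]| = size s /\ #|face_vertices [set:: s]| = size s.
Proof.
move=> Us'; rewrite face_vertices_seq !cardsE (card_uniqP Us') size_map.
by rewrite (card_uniqP (map_uniq Us')).
Qed.

Let ftri v := card_face (utri v : uniq (map fst (tri_darts a b v))).
Let fbsq v := card_face (ubsq v : uniq (map fst (bsq_darts b v))).
Let fcsq v := card_face (ucsq v : uniq (map fst (csq_darts a b v))).

Lemma labelled_closed_cells : closed_cell_faces M.
Proof.
apply/forall_inP => f /(faces_labelled lab)[v [] ->].
- by have [-> ->] := ftri v.
- by have [-> ->] := fbsq v.
by have [-> ->] := fcsq v.
Qed.

Lemma labelled_semi_equivelar : semi_equivelar [:: 3; 3; 4; 3; 4] M.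
Proof.
have [_ _ _ turns] := lab.
apply/forallP=> v; apply/existsP; exists (ci a b v).
rewrite nbhd_spokes in_set !inE eqxx !orbT /=; apply/orP; left; apply/eqP.
rewrite /face_sizes_around nbhd_spokes cardsE (card_uniqP (Us v)) /=.
have [t0 t1 t2 t3 t4] := turns v; rewrite t4 t0 t1 t2.
have E w u : w = u -> face_at M (w, v) = face_at M (u, v) by move->.
have -> : face_at M (ci a b v, v) = [set:: tri_darts a b (a (bi b (ci a b v)))].
  by rewrite -(face_at_c lab) ciK.
have -> : face_at M (a v, v) = [set:: tri_darts a b (a v)].
  by rewrite -(face_at_a lab) aK.
have -> : face_at M (b v, v) = [set:: bsq_darts b (b v)].
  by rewrite -(face_at_bi lab) /bi b4.
have -> : face_at M (bi b v, v) = [set:: tri_darts a b (a (bi b v))].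
  by rewrite -(face_at_b lab) /bi b4.
have -> : face_at M (a (bi b v), v) = [set:: csq_darts a b (a (bi b v))].
  by rewrite -(face_at_ci lab) cK.
by rewrite !(ftri _).2 (fbsq _).2 (fcsq _).2.
Qed.

Let card_fibers (f : V -> {set V * V}) k :
  (forall v, #|[set u | f u == f v]| = k) -> #|V| = #|f @: [set: V]| * k.
Proof.
move=> fib; rewrite -cardsT -sum1_card (partition_big_imset f) -sum_nat_const.
apply: eq_bigr => A /imsetP[v _ ->]; rewrite -(fib v) -sum1_card.
by apply: eq_bigl => u; rewrite !inE.
Qed.

Let face_at_eq d d' : (face_at M d == face_at M d') = (d \in face_at M d').
Proof. exact: eq_porbit_mem. Qed.

(** Each triangle contains exactly one dart [(v, a v)], and each 4-gon four darts of its kind. So n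
    vertices come with n triangles, n/4 4-gons of either kind and 5n darts. *)
Lemma labelled_euler : euler_char_zero M.
Proof.
pose FT v := face_at M (v, a v); pose FB v := face_at M (v, bi b v).
pose FC v := face_at M (v, ci a b v).
have nT : #|V| = #|FT @: [set: V]| * 1.
  apply: card_fibers => v; rewrite (_ : [set _ | _] = [set v]) ?cards1 //.
  apply/setP=> u; rewrite !inE face_at_eq (face_at_a lab) inE; apply/idP/eqP => [|->]; last first.
    by rewrite inE eqxx.
  rewrite !inE => /or3P[]/eqP[-> au] //; have := utri v; rewrite /tri.
    by rewrite -au aK /= !inE eqxx orbT.
  by rewrite -[ci a b v]aK au /= !inE eqxx ?orbT andbF.
have nB : #|V| = #|FB @: [set: V]| * 4.
  apply: card_fibers => v.
  rewrite (_ : [set _ | _] = [set:: bsq b v]) ?cardsE ?(card_uniqP (ubsq v)) //.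
  apply/setP=> u; rewrite !in_set face_at_eq (face_at_bi lab) in_set.
  apply/mapP/idP => [[x xv [-> _]] //|uv]; by exists u.
have nC : #|V| = #|FC @: [set: V]| * 4.
  apply: card_fibers => v.
  rewrite (_ : [set _ | _] = [set:: csq a b v]) ?cardsE ?(card_uniqP (ucsq v)) //.
  apply/setP=> u; rewrite !in_set face_at_eq (face_at_ci lab) in_set.
  apply/mapP/idP => [[x xv [-> _]] //|uv]; by exists u.
have nF : #|faces M| = #|FT @: [set: V]| + #|FB @: [set: V]| + #|FC @: [set: V]|.
  have -> : faces M = FT @: [set: V] :|: FB @: [set: V] :|: FC @: [set: V].
    apply/setP=> f; rewrite !inE; apply/(faces_labelled lab)/idP.
      case=> v [] ->; rewrite -?(face_at_a lab) -?(face_at_bi lab) -?(face_at_ci lab);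
        by rewrite -/(FT v) -/(FB v) -/(FC v) imset_f ?orbT ?in_setT.
    case/orP=> [/orP[]|] /imsetP[v _ ->]; exists v; [constructor 1|constructor 2|constructor 3];
      rewrite -?(face_at_a lab) -?(face_at_bi lab) -?(face_at_ci lab) //.
  have cT v : #|FT v| = 3 by rewrite /FT (face_at_a lab) (ftri v).1.
  have cB v : #|FB v| = 4 by rewrite /FB (face_at_bi lab) (fbsq v).1.
  have cC v : #|FC v| = 4 by rewrite /FC (face_at_ci lab) (fcsq v).1.
  have TB : FT @: [set: V] :&: FB @: [set: V] = set0.
    apply/setP=> f; rewrite !inE; apply/andP=> -[/imsetP[u _ ->] /imsetP[v _ uv]].
    by have := cT u; rewrite uv cB.
  have TBC : (FT @: [set: V] :|: FB @: [set: V]) :&: FC @: [set: V] = set0.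
    apply/setP=> f; rewrite !inE.
    apply/andP=> -[/orP[]/imsetP[u _ ->] /imsetP[v _ uv]]; first by have := cT u; rewrite uv cC.
    (* The two kinds of 4-gons differ because [bi b u] and [ci a b u] are distinct spokes. *)
    have : (u, bi b u) \in FC v by rewrite -uv porbit_id.
    rewrite /FC (face_at_ci lab) inE => /mapP[x _ [<- ux]].
    by have := Us u; rewrite /= -ux !inE eqxx !orbT !andbF.
  by rewrite cardsU TBC cardsU TB cards0 !subn0.
have nD : #|darts M| = #|V| * 5.
  rewrite (dartsE lab) -sum1dep_card.
  rewrite (eq_bigl (fun d : V * V => xpredT d.1 && (d.2 \in spokes a b d.1))) //.
  rewrite -(pair_big_dep xpredT (fun u v => v \in spokes a b u) (fun _ _ => 1)) /=.
  rewrite -sum_nat_const; apply: eq_bigr => v _.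
  by rewrite sum1_card (card_uniqP (Us v)).
by rewrite /euler_char_zero nD nF; lia.
Qed.

Lemma labelled_connected v0 :
  (forall v, connect (adj M) v v0) -> connected_graph M.
Proof.
move=> conn; apply/andP; split; first by apply/card_gt0P; exists v0.
have sym : connect_sym (adj M).
  by apply: sym_connect_sym => u v; apply/idP/idP; exact: adjC.
by apply/'forall_forallP => u v; rewrite (connect_trans (conn u)) // sym.
Qed.

Lemma labelled_polyhedral :
  (forall u v, allrel (@edge_compatible V) (face_darts a b u) (face_darts a b v)) ->
  polyhedral M.
Proof.
move=> compat; apply/forall_inP => f fM; apply/forall_inP => g gM; apply/implyP => fg.
have faceP h : h \in faces M -> exists v s, s \in face_darts a b v /\ h = [set:: s].
  case/(faces_labelled lab) => v [] ->; exists v;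
    [exists (tri_darts a b v)|exists (bsq_darts b v)|exists (csq_darts a b v)];
    by rewrite !in_cons eqxx ?orbT.
have [u [s [su fs]]] := faceP _ fM; have [v [t [tv gt]]] := faceP _ gM.
(* A common dart would force the two orbits to coincide, against [fg]. *)
have /orP[/hasP[d ds dt]|] := allrelP (compat u v) s t su tv.
  case/negP: fg; case/imsetP: fM => df _ fE; case/imsetP: gM => dg _ gE.
  have df' : d \in face_at M df by rewrite -fE fs inE.
  have dg' : d \in face_at M dg by rewrite -gE gt inE.
  by rewrite fE gE -(eqP (etrans (face_at_eq d df) df')) face_at_eq.
set I := [seq x <- _ | _].
have -> : face_vertices f :&: face_vertices g = [set:: I].
  apply/setP=> x; rewrite fs gt !face_vertices_seq in_setI !in_set mem_filter.
  by rewrite andbC.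
case/orP=> [sI|/hasP[d ds /and4P[dt d1 d2 /allP dI]]]; apply/orP; [left|right].
  by rewrite cardsE (leq_trans (card_size _)).
apply/existsP; exists d.1; apply/existsP; exists d.2.
rewrite fs gt !in_set -surjective_pairing ds dt !andbT; apply/eqP/setP=> x.
by rewrite !inE; apply/idP/orP=> [/dI/orP //|[]/eqP->].
Qed.

End Validity.

(** * Validity of a finite model as a Boolean test *)

Section OrdinalValidity.

Variables (n : nat) (a b : 'I_n.+1 -> 'I_n.+1).

(* Unlike inord and enum, inZp and iota evaluate under vm_compute. *)
Definition ords : seq 'I_n.+1 := map inZp (iota 0 n.+1).

Lemma mem_ords i : i \in ords.
Proof. by rewrite -[i]valZpK map_f // mem_iota ltn_ord. Qed.

(** The last local test ensures connectedness by induction on the number of a vertex. In a lattice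
    model the three words lower the rotation part, the first coordinate and the second
    coordinate. *)
Definition valid_model :=
  all (fun v => [&& a (a v) == v, iter 4 b v == v, iter 4 (ci a b) v == v,
    [&& uniq (v :: spokes a b v), uniq (bsq b v) & uniq (csq a b v)]
    & (v == ord0) || has (fun w : 'I_n.+1 => w < v) [:: bi b v; a (b (b v)); a (bi b v)]])
    ords
  && let fs := flatten [seq face_darts a b v | v <- ords] in
     allrel (@edge_compatible _) fs fs.

Lemma valid_model_action : valid_model -> snub_action a b.
Proof.
case/andP=> /allP loc _; split=> v;
  by have /and5P[/eqP h1 /eqP h2 /eqP h3 _ _] := loc v (mem_ords v).
Qed.

Lemma valid_modelP : valid_model ->
  exists2 M, M \in snub_square_torus_maps n.+1 & face_vertex_sets M = snub_faces a b.
Proof.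
move=> valid; have act := valid_model_action valid.
case/andP: valid => /allP loc /allrelP compat.
have simp : simple_action a b.
  by move=> v; have /and5P[] := loc v (mem_ords v).
have [M lab] := labelled_exists act simp.
exists M; last exact: face_vertex_sets_snub.
have adjE v u : u \in spokes a b v -> connect (adj M) v u.
  by move=> vu; apply: connect1; have [_ _ h _] := lab; rewrite -[adj M v u]/(u \in adj M v) h.
have cb v : connect (adj M) v (bi b v) by rewrite adjE // !inE eqxx !orbT.
have ca v : connect (adj M) v (a v) by rewrite adjE // !inE eqxx.
have cb' v : connect (adj M) v (b v) by rewrite adjE // !inE eqxx orbT.
have conn v : connect (adj M) v ord0.
  elim: {v}(val v) {-2}v (leqnn v) => [|k IHk] v; first by rewrite leqn0 => /eqP v0;
    rewrite (_ : v = ord0) //; apply: val_inj.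
  move=> vk; have /and5P[_ _ _ _ /orP[/eqP->//|/hasP[w + wv]]] := loc v (mem_ords v).
  have w0 : connect (adj M) w ord0 by apply: IHk; rewrite -ltnS (leq_trans wv).
  rewrite !inE => /or3P[]/eqP wE; apply: connect_trans w0; rewrite wE //.
    by do 2 apply: connect_trans (cb' _) _.
  by apply: connect_trans (cb _) _.
rewrite inE; apply/and3P; split; last exact: labelled_semi_equivelar lab simp.
  apply/and5P; split.
  - exact: labelled_simple_graph lab simp.
  - exact: (labelled_connected lab conn).
  - exact: labelled_cyclic_rotations lab.
  - exact: labelled_closed_cells lab simp.
  exact: labelled_euler lab simp.
apply: (labelled_polyhedral lab) => u v; apply/allrelP => s t su tv.
have inF w d : d \in face_darts a b w -> d \in flatten [seq face_darts a b v | v <- ords].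
  by move=> dw; apply/flatten_mapP; exists w; rewrite ?mem_ords.
exact: compat (inF _ _ su) (inF _ _ tv).
Qed.

End OrdinalValidity.

(** * Counting isomorphism classes *)

Section Invariant.

Variable V : finType.
Implicit Types (F : {set {set V}}) (A : {set V}).

Definition share_triangle F : rel V := fun u v =>
  [exists A in F, [&& #|A| == 3, u \in A & v \in A]].
(** Every side of a 4-gon in a map of this type also belongs to a triangle, so discarding pairs in a
    common triangle leaves the diagonals. *)
Definition square_diagonal F : rel V := fun u v =>
  [exists A in F, [&& #|A| == 4, u \in A & v \in A]] && ~~ share_triangle F u v.
Definition rel_img (R : rel V) A : {set V} := [set v | [exists u in A, R u v]].
Definition diagonal_reach F : nat :=
  \sum_u #|iter 3 (rel_img (square_diagonal F)) (rel_img (share_triangle F) [set u])|.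

Variable s : {perm V}.
Let sF F := [set s @: A | A : {set V} in F].

Let exists_sF F (P : pred {set V}) :
  [exists A in sF F, P A] = [exists A in F, P (s @: A)].
Proof.
apply/exists_inP/exists_inP => [[A /imsetP[B BF ->] PB]|[B BF PB]].
  by exists B.
by exists (s @: B) => //; apply: imset_f.
Qed.

Let share_sF F u v : share_triangle (sF F) (s u) (s v) = share_triangle F u v.
Proof.
rewrite /share_triangle exists_sF; apply: eq_existsb => A.
by rewrite card_imset ?mem_imset //; exact: perm_inj.
Qed.

Let diag_sF F u v : square_diagonal (sF F) (s u) (s v) = square_diagonal F u v.
Proof.
rewrite /square_diagonal share_sF exists_sF; congr (_ && _); apply: eq_existsb => A.
by rewrite card_imset ?mem_imset //; exact: perm_inj.
Qed.

Let img_sF (R R' : rel V) A : (forall u v, R' (s u) (s v) = R u v) ->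
  rel_img R' (s @: A) = s @: rel_img R A.
Proof.
move=> RR'; apply/setP=> v; rewrite -(permKV s v) mem_imset; last exact: perm_inj.
rewrite !inE; apply/exists_inP/exists_inP => [[_ /imsetP[u uA ->]]|[u uA]].
  by rewrite RR'; exists u.
by rewrite -RR'; exists (s u) => //; apply: imset_f.
Qed.

Lemma diagonal_reach_iso F : diagonal_reach (sF F) = diagonal_reach F.
Proof.
rewrite /diagonal_reach (reindex_inj (@perm_inj _ s)); apply: eq_bigr => u _.
rewrite -imset_set1 (img_sF _ (share_sF F)) /=.
by rewrite !(img_sF _ (diag_sF F)) card_imset //; exact: perm_inj.
Qed.

End Invariant.

Lemma card_equivalence_partition (T : finType) (R : rel T) (D : {set T}) (ms : seq T) :
  equivalence_rel R -> {subset ms <= D} -> uniq ms ->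
  {in ms &, forall x y, R x y -> x = y} ->
  (forall x, x \in D -> has (R x) ms) ->
  #|equivalence_partition R D| = size ms.
Proof.
move=> eqR sub Ums inj cov.
have refl x : R x x by case: (eqR x x x).
have left x y : R x y -> R x =1 R y by move=> xy z; case: (eqR x y z) => _; apply.
have sym x y : R x y -> R y x by move=> /left <-.
pose cls x := [set y in D | R x y].
have -> : equivalence_partition R D = cls @: [set:: ms].
  apply/setP=> C; apply/imsetP/imsetP => -[x]; rewrite ?inE => xD ->; last first.
    by exists x; rewrite ?sub.
  have /hasP[m mms xm] := cov x xD; exists m; rewrite ?inE //.
  by apply/setP=> y; rewrite !inE (left _ _ xm).
rewrite card_in_imset ?cardsE ?(card_uniqP Ums) // => x y; rewrite !inE => xms yms.
move/setP/(_ y); rewrite !inE refl sub // andbT /= => xy; apply: inj => //.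
Qed.

Lemma set_traject4_rev (V : finType) (f g : V -> V) v :
  cancel f g -> iter 4 f v = v -> [set:: traject g v 4] = [set:: traject f v 4].
Proof.
move=> fK f4; rewrite -{1}f4 /= !fK; apply/setP=> u; rewrite !inE.
move: f4 => /= ->.
by case: (u == v); case: (u == f v); case: (u == f (f v)); case: (u == f (f (f v))).
Qed.

(* Reversing the cyclic order at each vertex turns b into ci. *)
Lemma snub_faces_mirror (V : finType) (a b : V -> V) :
  snub_action a b -> snub_faces a (ci a b) = snub_faces a b.
Proof.
case=> aK b4 c4.
have ciE v : ci a (ci a b) v = b v by rewrite /ci aK.
have sb v : [set:: csq a (ci a b) v] = [set:: bsq b v].
  have -> : csq a (ci a b) v = traject b v 4 by rewrite /csq /= !ciE.
  apply/esym/set_traject4_rev => // u; exact: b4.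
have sc v : [set:: bsq (ci a b) v] = [set:: csq a b v].
  apply: set_traject4_rev => // u; exact: c4.
have st v : [set:: tri a (ci a b) v] = [set:: tri a b (a v)].
  apply/setP=> u; rewrite !inE ciE /ci aK.
  by case: (u == v); case: (u == a v).
apply/setP=> A; apply/snub_facesP/snub_facesP => -[v [] ->].
- by exists (a v); rewrite -st; constructor 1.
- by exists v; rewrite sc; constructor 3.
- by exists v; rewrite sb; constructor 2.
- by exists (a v); rewrite st aK; constructor 1.
- by exists v; rewrite -sb; constructor 3.
by exists v; rewrite -sc; constructor 2.
Qed.

Lemma uniq_map_inj (T U : eqType) (f : T -> U) (s : seq T) :
  uniq (map f s) -> {in s &, injective f}.
Proof.
move=> Ufs x y xs ys fxy; rewrite -(nth_index x xs) -(nth_index x ys); congr nth.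
apply/eqP; rewrite -(nth_uniq (f x) _ _ Ufs) ?size_map ?index_mem //.
by rewrite !(nth_map x) ?index_mem // !nth_index // fxy.
Qed.

(** * Evaluating the invariant and comparing lattice models *)

Section OrdinalFaces.

Variable n : nat.
Notation V := 'I_n.+1.
Implicit Types a b : V -> V.

Definition face_list a b : seq (seq V) :=
  flatten [seq [:: tri a b v; bsq b v; csq a b v] | v <- ords n].

Lemma face_listP a b A : reflect (exists2 l, l \in face_list a b & A = [set:: l])
  (A \in snub_faces a b).
Proof.
apply: (iffP (snub_facesP _ _ _)) => [[v Av]|[l /flatten_mapP[v _]]].
  have L l : l \in [:: tri a b v; bsq b v; csq a b v] -> l \in face_list a b.
    by move=> lv; apply/flatten_mapP; exists v; rewrite ?mem_ords.
  by case: Av => ->; [exists (tri a b v)|exists (bsq b v)|exists (csq a b v)];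
    rewrite // L // !in_cons eqxx ?orbT.
by rewrite !in_cons orbF => /or3P[]/eqP-> ->; exists v; constructor.
Qed.

(** A relation is tabulated by its lists of images, so that iterating it no longer searches the
    faces. *)
Definition table_img (t : seq (seq V)) (s : seq V) : seq V :=
  undup (flatten [seq nth [::] t (val u) | u <- s]).
Definition share_face (fs : seq (seq V)) k u : seq V :=
  undup (flatten [seq l <- fs | (size (undup l) == k) && (u \in l)]).
Definition compute_diagonal_reach a b : nat :=
  let fs := face_list a b in
  let t := [seq share_face fs 3 u | u <- ords n] in
  let d := [seq [seq v <- share_face fs 4 u | v \notin share_face fs 3 u] | u <- ords n] in
  sumn [seq size (iter 3 (table_img d) (table_img t [:: u])) | u <- ords n].

Lemma card_seq_set (T : finType) (l : seq T) : #|[set:: l]| = size (undup l).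
Proof.
rewrite cardsE -(card_uniqP (undup_uniq l)).
by apply: eq_card => x; rewrite mem_undup.
Qed.

Let nth_ords (u : V) : nth ord0 (ords n) u = u.
Proof. by rewrite (nth_map 0) ?size_iota ?ltn_ord // nth_iota ?ltn_ord // valZpK. Qed.

Let size_ords : size (ords n) = n.+1. Proof. by rewrite size_map size_iota. Qed.

Lemma diagonal_reachE a b : diagonal_reach (snub_faces a b) = compute_diagonal_reach a b.
Proof.
rewrite /compute_diagonal_reach; set share := share_face (face_list a b).
have shareE k u v : [exists A in snub_faces a b, [&& #|A| == k, u \in A & v \in A]]
    = (v \in share k u).
  rewrite mem_undup; apply/exists_inP/flattenP => [[_ /face_listP[l lF ->]]|[l]].
    by rewrite card_seq_set !inE => /and3P[k_l ul vl]; exists l; rewrite // mem_filter k_l ul.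
  rewrite mem_filter => /andP[/andP[k_l ul] lF] vl.
  by exists [set:: l]; [apply/face_listP; exists l|rewrite card_seq_set !inE k_l ul].
have imgE (R : rel V) f s : (forall u v, R u v = (v \in f u)) ->
    rel_img R [set:: s] = [set:: table_img [seq f u | u <- ords n] s].
  move=> Rf; apply/setP=> v; rewrite !inE mem_undup; apply/exists_inP/flatten_mapP.
    case=> u; rewrite inE Rf => us uv; exists u => //.
    by rewrite (nth_map ord0) ?size_ords ?ltn_ord // (nth_ords u).
  case=> u us; rewrite (nth_map ord0) ?size_ords ?ltn_ord // (nth_ords u) -Rf => uv.
  by exists u; rewrite ?inE.
have shE u v : share_triangle (snub_faces a b) u v = (v \in share 3 u) by apply: shareE.
have diE u v : square_diagonal (snub_faces a b) u v
    = (v \in [seq w <- share 4 u | w \notin share 3 u]).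
  by rewrite /square_diagonal shareE shE mem_filter andbC.
rewrite sumnE big_map big_map /diagonal_reach.
rewrite (_ : iota 0 n.+1 = index_iota 0 n.+1); last by rewrite /index_iota subn0.
rewrite big_mkord; apply: eq_bigr => u _; rewrite valZpK.
rewrite (_ : [set u] = [set:: [:: u]]); last by apply/setP=> v; rewrite !inE.
rewrite (imgE _ _ _ shE) [iter _ _ _]/= !(imgE _ _ _ diE) card_seq_set undup_id //.
exact: undup_uniq.
Qed.

Definition intertwines a b a' b' (g : V -> V) : bool :=
  uniq (map g (ords n))
  && all (fun v => (a (g v) == g (a' v)) && (b (g v) == g (b' v))) (ords n).

Lemma intertwinesP a b a' b' g : intertwines a b a' b' g ->
  exists s : {perm V},
    snub_faces a b = [set s @: A | A : {set V} in snub_faces a' b'].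
Proof.
case/andP=> Ug /allP ab; have g_inj : injective g.
  move=> u v guv; rewrite -[u]nth_ords -[v]nth_ords; congr nth.
  apply/eqP; rewrite -(nth_uniq (g ord0) _ _ Ug) ?size_map ?size_iota ?ltn_ord //.
  by rewrite !(nth_map ord0) ?size_ords ?ltn_ord // !nth_ords guv.
exists (perm g_inj); apply: snub_faces_relabel => v; rewrite !permE;
  by have /andP[/eqP ? /eqP ?] := ab v (mem_ords v).
Qed.

(* The choice of v among b^i v0, i < 4, and of the orientation range over the
   eight symmetries of the square lattice. *)
Definition model_covers p q r p' q' r' : bool :=
  let a := @ord_a n p q r in let b := @ord_b n in let a' := @ord_a n p' q' r' in
  has (fun v => intertwines a b a' b (walk a b r' v)
             || intertwines a b a' (ci a' b) (walk a (ci a b) r' v))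
    (take 4 (ords n)).

Lemma model_coversP p q r p' q' r' :
  snub_action (@ord_a n p' q' r') (@ord_b n) -> model_covers p q r p' q' r' ->
  exists s : {perm V}, snub_faces (@ord_a n p q r) (@ord_b n)
    = [set s @: A | A : {set V} in snub_faces (@ord_a n p' q' r') (@ord_b n)].
Proof.
move=> act /hasP[v _ /orP[]]; first exact: intertwinesP.
by rewrite -(snub_faces_mirror act); exact: intertwinesP.
Qed.

Definition valid_params (t : nat * nat * nat) : bool :=
  let: (p, q, r) := t in valid_model (@ord_a n p q r) (@ord_b n).

Definition params_faces (t : nat * nat * nat) : {set {set V}} :=
  let: (p, q, r) := t in snub_faces (@ord_a n p q r) (@ord_b n).

Definition params_reach (t : nat * nat * nat) : nat :=
  let: (p, q, r) := t in compute_diagonal_reach (@ord_a n p q r) (@ord_b n).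

(** The [if]s, unlike [==>], keep call-by-value evaluation from running the covering test on triples
    that are not admissible. *)
Definition admissible_covered (reps : seq (nat * nat * nat)) : bool :=
  all (fun p => all (fun r => if 4 * p * r == n.+1 then
      all (fun q => if admissible p q r then
          has (fun t => let: (p', q', r') := t in model_covers p q r p' q' r') reps
        else true) (iota 0 r)
    else true) (iota 0 (n.+1 %/ 4).+1)) (iota 0 (n.+1 %/ 4).+1).

(** The invariant separates the representatives. Conversely every map is a relabelled admissible
    model, which is covered by a representative. *)
Lemma num_iso_classes_reps (reps : seq (nat * nat * nat)) :
  [&& all valid_params reps, uniq (map params_reach reps) & admissible_covered reps] ->
  num_iso_classes n.+1 = size reps.
Proof.
case/and3P=> valid Ureach cover.
have reachE t : diagonal_reach (params_faces t) = params_reach t.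
  by case: t => [[p q] r]; exact: diagonal_reachE.
have [ms [msD msF]] : exists ms, {subset ms <= snub_square_torus_maps n.+1}
    /\ map (@face_vertex_sets V) ms = map params_faces reps.
  elim: reps valid {Ureach cover} => [|[[p q] r] reps IH] /=; first by exists [::].
  case/andP=> /valid_modelP[M MD MF] /IH[ms [msD msF]]; exists (M :: ms); split.
    by move=> x; rewrite inE => /predU1P[->|/msD].
  by rewrite /= MF msF.
have Ums : uniq (map (@diagonal_reach V \o @face_vertex_sets V) ms).
  by rewrite map_comp msF -map_comp (eq_map reachE).
have <- : size ms = size reps by rewrite -(size_map (@face_vertex_sets V)) msF size_map.
apply: card_equivalence_partition => //.
- exact: map_iso_equiv.
- exact: map_uniq Ums.
- move=> x y xms yms /existsP[s /eqP xy]; apply: (uniq_map_inj Ums) => //=.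
  by rewrite -xy diagonal_reach_iso.
move=> M MD; have [p [q [r [s [adm card MF]]]]] := labelled_relabel MD.
have [p0 q_r r0 _] := and4P adm.
have pr : n.+1 %/ 4 = p * r by rewrite -card -mulnA mulKn.
have pI : p \in iota 0 (n.+1 %/ 4).+1 by rewrite pr mem_iota ltnS leq_pmulr // ltnW.
have rI : r \in iota 0 (n.+1 %/ 4).+1 by rewrite pr mem_iota ltnS leq_pmull.
have := allP (allP cover p pI) r rI; rewrite card eqxx => /allP/(_ q).
rewrite mem_iota adm => /(_ q_r)/hasP[[[p' q'] r'] t_reps].
case/model_coversP=> [|s' sF]; first exact: valid_model_action (allP valid _ t_reps).
have : params_faces (p', q', r') \in map (@face_vertex_sets V) ms by rewrite msF map_f.
case/mapP=> M' M'ms FM'; apply/hasP; exists M' => //.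
have symR (x y : rotation_system V) : map_iso x y -> map_iso y x.
  by move=> xy; have [xx /(_ xy) <-] := map_iso_equiv x y x.
(* [s'] relabels the representative as the model found for [M], and [s] relabels that model as
   [M]. *)
apply: symR; apply/existsP; exists (s' * s)%g; apply/eqP.
rewrite MF -[face_vertex_sets M']FM' sF -imset_comp; apply: eq_imset => A /=.
by rewrite -imset_comp; apply: eq_imset => u; rewrite permM.
Qed.

End OrdinalFaces.

(** * The representatives with at most 32 vertices *)

Definition snub_square_reps (n : nat) : seq (nat * nat * nat) :=
  match n with
  | 16 => [:: (1, 2, 4); (2, 0, 2)]
  | 20 => [:: (1, 2, 5)]
  | 24 => [:: (1, 2, 6); (1, 3, 6); (2, 0, 3)]
  | 28 => [:: (1, 2, 7)]
  | 32 => [:: (1, 2, 8); (1, 3, 8); (1, 4, 8); (2, 0, 4); (2, 2, 4)]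
  | _ => [::]
  end.

(** Where the list of representatives is empty, the covering test says that no admissible triple
    gives that number of vertices. *)
Lemma snub_square_reps_checked :
  all (fun n => let reps := snub_square_reps n.+1 in
    [&& all (valid_params n) reps, uniq (map (params_reach n) reps)
      & admissible_covered n reps]) (iota 0 32).
Proof. by vm_cast_no_check (erefl true). Qed.

Lemma num_iso_classes_small (n : nat) :
  n <= 32 -> num_iso_classes n = size (snub_square_reps n).
Proof.
(* The models have at least one vertex; for none, [connected_graph] already fails. *)
case: n => [_|n n32]; last first.
  by apply: num_iso_classes_reps; apply: (allP snub_square_reps_checked); rewrite mem_iota.
have empty M : M \notin snub_square_torus_maps 0.
  by rewrite inE /torus_map /connected_graph card_ord ltnn /= andbF.
rewrite /num_iso_classes (_ : snub_square_torus_maps 0 = set0); last first.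
  by apply/setP=> M; rewrite (negPf (empty M)) inE.
apply: eq_card0 => C; rewrite -[LHS]/(C \in _).
by apply/imsetP => -[M]; rewrite inE.
Qed.

Theorem theorem2p4 :
  [/\ num_iso_classes 16 = 2,
      num_iso_classes 20 = 1,
      num_iso_classes 24 = 3,
      num_iso_classes 28 = 1
    & num_iso_classes 32 = 5] /\
  (forall n : nat, n <= 32 -> n \notin [:: 16; 20; 24; 28; 32] ->
     num_iso_classes n = 0).
Proof.
split; first by split; rewrite num_iso_classes_small.
move=> n n32; rewrite num_iso_classes_small // !inE.
by do 33 case: n n32 => [|n] n32 //.
Qed.
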